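(* Suppose $p$ is a symmetric $\delta\times\delta$ matrix-valued free polynomial of degree $d$ in $g$ variables such that $p(0)$ is invertible and $\mathcal D_p$ is bounded and convex. Let $\nu=\delta\sum_{j=0}^d g^j$ and $\breve\nu=\delta\sum_{j=0}^{[d/2]}g^j$, where $[d/2]$ is the largest integer less than or equal to $d/2$. (i) There is an $\ell\le\frac{\nu(\nu+1)}2$ and $\ell\times\ell$ real symmetric matrices $A_1,\dots,A_g$ such that $\mathcal D_p=\mathcal D_L$, where $L$ is the monic linear pencil $L=I-\sum_{j=1}^gA_jx_j$. (ii) In the case that $p(0)=I_\delta$, the bound on the size $\ell$ of the matrices $A_j$ in (i) can be reduced to $\ell\le\frac{\breve\nu(\breve\nu+1)}2$.
   Context: Fix a positive integer $g$. $\mathcal P$ denotes the free algebra of polynomials with real coefficients in freely noncommuting variables $x=(x_1,\dots,x_g)$, and $\mathcal P^{\delta\times\delta}$ the $\delta\times\delta$ matrices over $\mathcal P$. Write $p\in\mathcal P^{\delta\times\delta}$ as a finite sum $p=\sum_w p_w w$ over words $w$ with real $\delta\times\delta$ matrices $p_w$; its degree is the maximal length of a word with $p_w\neq0$. The involution is $p^T=\sum_w p_w^T w^T$, where $w^T$ is the reversed word; $p$ is symmetric if $p^T=p$. $\mathbb S_n(\mathbb R^g)$ is the set of $g$-tuples $X$ of real symmetric $n\times n$ matrices; $p(X)=\sum_w p_w\otimes w(X)$, where $w(X)=X_{j_1}\cdots X_{j_k}$ for $w=x_{j_1}\cdots x_{j_k}$ and $\emptyset(X)=I_n$; $p(0)=p_\emptyset$.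 For symmetric $p$ with $p(0)$ invertible, $\mathcal D_p=(\mathcal D_p(n))_{n\ge1}$, where $\mathcal D_p(n)$ is the connected component containing $0$ of $\{X\in\mathbb S_n(\mathbb R^g):p(X)\text{ is invertible}\}$. $\mathcal D_p$ is convex if each $\mathcal D_p(n)$ is convex, and bounded if there is a constant $K$ with $\sum_j\|X_j\|\le K$ for all $n$ and $X\in\mathcal D_p(n)$. For a monic linear pencil $L$, i.e. an affine linear symmetric matrix polynomial with $L(0)=I$, $\mathcal D_L(n)=\{X\in\mathbb S_n(\mathbb R^g):L(X)\succ0\}$; $\mathcal D_p=\mathcal D_L$ means $\mathcal D_p(n)=\mathcal D_L(n)$ for every $n$. *)

(* Defs.v *)
From HB Require Import structures.
From mathcomp Require Import all_boot all_order all_algebra finmap.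
From mathcomp Require Import all_classical all_reals all_analysis.
From mathcomp Require Export mxtens.

Set Implicit Arguments.
Unset Strict Implicit.
Unset Printing Implicit Defensive.

Import Order.TTheory GRing.Theory Num.Theory.
Import numFieldNormedType.Exports.

Local Open Scope classical_set_scope.
Local Open Scope ring_scope.

Notation "A *t B" := (tensmx A B)
  (at level 40, left associativity, format "A  *t  B") : ring_scope.

(* p : free_poly R g d is a d x d matrix-valued polynomial in g freely
   noncommuting variables; a word x_{j_1} ... x_{j_k} is the sequence
   [:: j_1; ...; j_k], and p w is the coefficient p_w. *)
Definition free_poly (R : realType) (g d : nat) :=
  {fsfun seq 'I_g -> 'M[R]_d with 0}.

Section FreePolynomials.
Variables (R : realType) (g : nat).

Section Basics.
Variable d : nat.
Implicit Type p : free_poly R g d.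

Definition fp_degree p : nat := (\max_(w <- finsupp p) size w)%N.

Definition fp_adj p : free_poly R g d :=
  [fsfun w in [fset rev w | w in finsupp p]%fset => (p (rev w))^T].

Definition fp_symmetric p : Prop := fp_adj p = p.

Definition word_eval n (X : 'I_g -> 'M[R]_n) (w : seq 'I_g) : 'M[R]_n :=
  \big[mulmx/1%:M]_(j <- w) X j.

Definition fp_eval n p (X : 'I_g -> 'M[R]_n) : 'M[R]_(d * n) :=
  \sum_(w <- finsupp p) p w *t word_eval X w.

Lemma fp_adjE p w : fp_adj p w = (p (rev w))^T.
Proof.
rewrite fsfunE; case: ifPn => // wp; rewrite fsfun_dflt ?trmx0 //.
apply: contra wp => wp; apply/imfsetP; exists (rev w) => //=.
by rewrite revK.
Qed.

End Basics.

Definition symmetric_tuples n : set ('I_g -> 'M[R]_n) :=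
  [set X | forall j, (X j)^T = X j].

(* The component is taken in the product topology of the g factors 'M[R]_n. *)
Definition invertibility_component d (p : free_poly R g d) n :
    set ('I_g -> 'M[R]_n) :=
  connected_component
    ([set X | symmetric_tuples X /\ fp_eval p X \in unitmx]
       : set {ptws 'I_g -> 'M[R]_n})
    (fun _ => 0).

Definition vec_norm n (v : 'cV[R]_n) : R :=
  Num.sqrt (\sum_(i < n) v i ord0 ^+ 2).

Definition op_norm n (M : 'M[R]_n) : R :=
  sup [set vec_norm (M *m v) | v in [set v | vec_norm v <= 1]].

Definition free_set := forall n, set ('I_g -> 'M[R]_n).

Definition free_convex (D : free_set) : Prop :=
  forall n, (0 < n)%N -> convex_set (D n).

Definition free_bounded (D : free_set) : Prop :=
  exists K : R, forall n, (0 < n)%N ->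
    forall X, D n X -> \sum_(j < g) op_norm (X j) <= K.

Definition posdef n (M : 'M[R]_n) : Prop :=
  M^T = M /\ forall v : 'cV[R]_n, v != 0 -> 0 < (v^T *m M *m v) ord0 ord0.

Definition positivity_domain l (L : free_poly R g l) : free_set :=
  fun n => [set X | symmetric_tuples X /\ posdef (fp_eval L X)].

Section Pencil.
Variables (l : nat) (A : 'I_g -> 'M[R]_l).

(* I - \sum_j A_j x_j *)
Definition monic_pencil : free_poly R g l :=
  [fsfun w in [fset w in [::] :: [seq [:: j] | j <- enum 'I_g]]%fset =>
    match w with
    | [::] => 1%:M
    | [:: j] => - A j
    | _ => 0
    end].

Lemma monic_pencilE w :
  monic_pencil w = match w with [::] => 1%:M | [:: j] => - A j | _ => 0 end.
Proof.
rewrite fsfunE; case: ifPn => // wp.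
case: w wp => [|j [|? ?]] //; rewrite !inE //=.
by rewrite mem_map ?mem_enum // => ? ? [].
Qed.

Lemma fp_eval_monic_pencil n (X : 'I_g -> 'M[R]_n) :
  fp_eval monic_pencil X = 1%:M - \sum_(j < g) A j *t X j.
Proof.
set s : seq (seq 'I_g) := [::] :: [seq [:: j] | j <- enum 'I_g].
have us : uniq s.
  rewrite /= map_inj_uniq ?enum_uniq ?andbT; last by move=> ? ? [].
  by apply/mapP => -[].
have -> : fp_eval monic_pencil X
          = \sum_(w <- s) monic_pencil w *t word_eval X w.
  have sub w : w \in finsupp monic_pencil -> w \in s.
    rewrite mem_finsupp monic_pencilE; case: w => [|j [|? ?]] //.
    - by rewrite /s inE => _; apply/orP; right; apply/mapP; exists j;
        rewrite ?mem_enum.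
    - by rewrite eqxx.
  rewrite (bigID (fun w => w \in finsupp monic_pencil)) /=.
  rewrite [X in _ + X]big1 ?addr0; last first.
    by move=> w /fsfun_dflt ->; rewrite tens0mx.
  rewrite -big_filter; apply: perm_big.
  apply: uniq_perm; rewrite ?filter_uniq ?fset_uniq // => w.
  by rewrite mem_filter; case: (boolP (w \in finsupp _)) => // /sub ->.
rewrite big_cons big_map big_enum /= monic_pencilE /word_eval big_nil.
congr (_ + _).
  apply/matrixP => i j; rewrite -[i]mxtens_unindexK -[j]mxtens_unindexK.
  case: (mxtens_unindex i) (mxtens_unindex j) => a b [c e].
  rewrite tensmxE !mxE (can_eq (@mxtens_indexK _ _)) xpair_eqE.
  by case: eqP; case: eqP; rewrite ?mulr1 ?mul0r ?mulr0.
rewrite -sumrN; apply: eq_bigr => j _; rewrite monic_pencilE /word_eval big_cons big_nil mulmx1.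
by apply/matrixP => i k; rewrite !mxE mulNr.
Qed.

End Pencil.
End FreePolynomials.

Arguments invertibility_component {R g d} p n.
Arguments positivity_domain {R g l} L n.

(* Main.v *)
(** The domain [D] is, by convexity, the set of [X] with [p(tX)] invertible for
    all [t] in [0, 1]; it is closed under direct sums, and convexity makes it
    closed under compression to a subspace.  If [p(X) v = 0] with [v <> 0], let
    the columns of [Phi] be the vectors [w(X) v_b] with [w] of length at most [d]
    ([d/2] when [p(0) = I]).  The Gram data [(Phi^T Phi, Phi^T X_j Phi)] remembers
    that [v] is a null vector of [p(X)], so it cannot equal
    [(C^T C, C^T Y_j C)] with [Y] in [D].  Both kinds of data form convex cones in
    a space of fixed dimension (direct sums add them), and a functional separating
    the two cones is a pencil [T - sum_j B_j x_j] with [T] and the [B_j] of the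
    size [k] of the Gram matrices.  Normalising [T] on its range, of dimension [e],
    gives a monic pencil of size [e] that is nonnegative on [D] and is not positive
    at any [X] with [Phi] nonzero on that range; the remaining pairs [(X, Phi)] live
    on a quotient of dimension [k - e], and induction yields a direct sum of total
    size [k], which is [delta * sum_j g^j]. *)
Require Import Defs.
From mathcomp Require Import all_boot all_order all_algebra finmap.
From mathcomp Require Import all_classical all_reals all_analysis.
From mathcomp Require Import polyrcf ring lra.

Set Implicit Arguments.
Unset Strict Implicit.
Unset Printing Implicit Defensive.

Import Order.TTheory GRing.Theory Num.Theory.
Import numFieldNormedType.Exports.

Local Open Scope classical_set_scope.
Local Open Scope ring_scope.

(** * Positive semidefinite matrices: factorization and perturbation *)

Section PositiveSemidefinite.
Variable R : realType.

Definition psd k (T : 'M[R]_k) : Prop :=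
  T^T = T /\ forall v : 'cV[R]_k, 0 <= (v^T *m T *m v) 0 0.

Lemma psd_congr k r (T : 'M[R]_k) (P : 'M[R]_(k, r)) :
  psd T -> psd (P^T *m T *m P).
Proof.
move=> [sT pT]; split; first by rewrite !trmx_mul trmxK sT mulmxA.
move=> v; have := pT (P *m v).
by rewrite trmx_mul !mulmxA.
Qed.

Lemma mulmx_tr_eq0 n k (A : 'M[R]_(n, k)) : A^T *m A = 0 -> A = 0.
Proof.
move/matrixP => H; apply/matrixP => i j; have := H j j; rewrite !mxE => /eqP.
rewrite psumr_eq0 => [|i' _]; last by rewrite mxE -expr2 sqr_ge0.
move/allP/(_ i (mem_index_enum _)); rewrite mxE -expr2 sqrf_eq0.
by move/eqP.
Qed.

(** By polarization, a symmetric matrix whose quadratic form vanishes identically is zero; otherwise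
    a vector with positive form value is rescaled. *)
Lemma psd_neq0 k (T : 'M[R]_k) :
  psd T -> T != 0 -> exists x : 'cV[R]_k, (x^T *m T *m x) 0 0 = 1.
Proof.
move=> [sT pT] T0.
have [[x /eqP x0]|H] := pselect (exists x : 'cV[R]_k, (x^T *m T *m x) 0 0 <> 0).
  set c := (x^T *m T *m x) 0 0 in x0.
  have c0 : 0 < c by rewrite lt_neqAle eq_sym x0 pT.
  exists ((Num.sqrt c)^-1 *: x).
  rewrite [(_ *: x)^T]linearZ /= -!scalemxAl -scalemxAr mxE [X in _ * X]mxE -/c.
  rewrite mulrA -expr2 exprVn sqr_sqrtr ?ltW // mulVf //.
case/negP: T0; apply/eqP/matrixP => i j; rewrite mxE.
have H0 (x : 'cV[R]_k) : (x^T *m T *m x) 0 0 = 0 :> R.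
  by apply: contrapT => ?; apply: H; exists x.
pose e i : 'cV[R]_k := delta_mx i 0.
have E i' j' : ((e i')^T *m T *m e j') 0 0 = T i' j'.
  by rewrite /e trmx_delta -rowE -colE !mxE.
have := H0 (e i + e j).
rewrite [(_ + _)^T]linearD /= !mulmxDl !mulmxDr [X in X = 0 -> _]mxE.
rewrite [X in X + _ = 0 -> _]mxE [X in _ + X = 0 -> _]mxE.
rewrite !E.
have := H0 (e i); have := H0 (e j); rewrite !E.
have : T j i = T i j by rewrite -[in LHS]sT mxE.
lra.
Qed.

(** Rank-one deflation: subtracting (T x)(T x)^T with x^T T x = 1 keeps the matrix positive
    semidefinite and adds [x] to its kernel, so the rank drops. The right inverse [G] records that
    [F] has full row rank. *)
Lemma psd_factor k (T : 'M[R]_k) : psd T ->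
  exists r (F : 'M[R]_(r, k)) (G : 'M[R]_(k, r)), T = F^T *m F /\ F *m G = 1%:M.
Proof.
have [n] := ubnP (\rank T); elim: n T => // n IHn T rT pT.
have [T0|T0] := eqVneq T 0.
  exists 0%N, 0, 0; rewrite T0 trmx0 mul0mx; split=> //.
  by apply/matrixP => -[].
have [x xTx] := psd_neq0 pT T0; have sT := pT.1.
have xTx1 : x^T *m T *m x = 1%:M by rewrite [LHS]mx11_scalar xTx.
pose P : 'M[R]_k := 1%:M - x *m x^T *m T.
pose T' := P^T *m T *m P.
have T'E : T' = T - T *m x *m x^T *m T.
  rewrite /T' /P [(_ - _)^T]linearB /= trmx1 !trmx_mul sT trmxK mulmxBl mul1mx.
  rewrite mulmxBr mulmx1 mulmxBl !mulmxA.
  rewrite -[T *m x *m x^T *m T *m x]mulmxA -[T *m x *m x^T *m (T *m x)]mulmxA.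
  by rewrite [x^T *m _]mulmxA xTx1 mulmx1 subrr subr0.
have T'x : T' *m x = 0.
  rewrite T'E mulmxBl -[T *m x *m x^T *m T *m x]mulmxA.
  by rewrite -[T *m x *m x^T *m (T *m x)]mulmxA [x^T *m _]mulmxA xTx1 mulmx1 subrr.
have T'T : (T' <= T)%MS.
  by rewrite T'E addmx_sub // eqmx_opp submxMl.
have rT' : (\rank T' < n)%N.
  rewrite ltnS in rT; apply: leq_trans rT; rewrite ltn_neqAle (mxrank_leqif_sup T'T).
  rewrite mxrankS // andbT; apply/negP => /submxP[N TN].
  have : x^T *m T *m x = 0 by rewrite -mulmxA TN -[N *m _ *m x]mulmxA T'x !mulmx0.
  by rewrite xTx1 => /matrixP/(_ 0 0)/eqP; rewrite !mxE eqxx oner_eq0.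
have [r [F [G [T'F FG]]]] := IHn T' rT' (psd_congr P pT).
have Fx : F *m x = 0.
  apply: mulmx_tr_eq0.
  by rewrite trmx_mul mulmxA -[_ *m _ *m F]mulmxA -T'F -mulmxA T'x mulmx0.
(* The new row of the factor is x^T T; the correction of [G] makes its columns orthogonal to [x] for
   the form of [T]. *)
exists (1 + r)%N, (col_mx (x^T *m T) F), (row_mx x (G - x *m (x^T *m T *m G))); split.
  rewrite tr_col_mx mul_row_col -T'F T'E trmx_mul trmxK sT !mulmxA.
  by rewrite addrC subrK.
rewrite mul_col_row !mulmxBr !mulmxA xTx1 mul1mx subrr Fx !mul0mx subr0 FG.
by rewrite -scalar_mx_block.
Qed.

Lemma psd_near1 k (S : 'M[R]_k) :
  S^T = S -> \sum_i \sum_j S i j ^+ 2 <= 1 -> psd (1%:M + S).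
Proof.
move=> sS S1; split; first by rewrite [LHS]linearD /= trmx1 sS.
move=> v; pose N := (v^T *m v) 0 0.
have NE : N = \sum_i v i 0 ^+ 2.
  by rewrite /N mxE; apply: eq_bigr => i _; rewrite mxE.
have N0 : 0 <= N by rewrite NE sumr_ge0 // => ? _; rewrite sqr_ge0.
rewrite mulmxDr mulmxDl mulmx1 mxE -/N.
have [Nz|Nz] := eqVneq N 0.
  have -> : v = 0 by apply: mulmx_tr_eq0; rewrite [LHS]mx11_scalar -/N Nz raddf0.
  by rewrite mulmx0 mxE addr0.
(* Cauchy-Schwarz in the form of the sum over i, j of (N S_ij + v_i v_j)^2 >= 0. *)
have bound : - (2 * N * (v^T *m S *m v) 0 0) <= 2 * N ^+ 2.
  have -> : 2 * N ^+ 2 = N ^+ 2 * 1 + N * N by ring.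
  apply: (@le_trans _ _ (N ^+ 2 * \sum_i \sum_j S i j ^+ 2 + N * N)); last first.
    by rewrite lerD2r ler_wpM2l // sqr_ge0.
  have -> : N * N = \sum_i \sum_j v i 0 ^+ 2 * v j 0 ^+ 2.
    rewrite {1}NE mulr_suml; apply: eq_bigr => i _.
    by rewrite NE mulr_sumr.
  rewrite -mulmxA mxE !mulr_sumr -big_split /= -sumrN.
  apply: ler_sum => i _; rewrite !mxE !mulr_sumr -big_split /= -sumrN.
  apply: ler_sum => j _.
  have := sqr_ge0 (N * S i j + v i 0 * v j 0); nra.
have Np : 0 < 2 * N by rewrite mulr_gt0 // lt_neqAle eq_sym Nz.
by rewrite -(pmulr_rge0 _ Np); nra.
Qed.

Lemma psd_absorb k (S : 'M[R]_k) : S^T = S ->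
  exists2 c, 0 < c & forall s, 0 <= s <= c -> psd (1%:M + s *: S).
Proof.
move=> sS; pose b := \sum_i \sum_j S i j ^+ 2.
have b0 : 0 <= b by do 2 apply: sumr_ge0 => ? _; rewrite sqr_ge0.
(* From s (1 + b) <= 1 follow s <= 1 and s b <= 1, hence s^2 b <= 1. *)
exists (1 + b)^-1; first by rewrite invr_gt0 ltr_pwDl.
move=> s /andP[s0 sb]; apply: psd_near1; first by rewrite [LHS]linearZ /= sS.
have -> : \sum_i \sum_j (s *: S) i j ^+ 2 = s ^+ 2 * b.
  rewrite mulr_sumr; apply: eq_bigr => i _; rewrite mulr_sumr.
  by apply: eq_bigr => j _; rewrite mxE exprMn.
have : s * (1 + b) <= 1 by rewrite -ler_pdivlMr ?ltr_pwDl // div1r.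
nra.
Qed.

Lemma psd_kernel k (M : 'M[R]_k) (v : 'cV[R]_k) :
  psd M -> (v^T *m M *m v) 0 0 = 0 -> M *m v = 0.
Proof.
move=> /psd_factor[r [F [_ [-> _]]]] v0.
have Fv : F *m v = 0.
  apply: mulmx_tr_eq0; rewrite [LHS]mx11_scalar trmx_mul !mulmxA.
  by rewrite -[v^T *m F^T *m F]mulmxA v0 raddf0.
by rewrite -mulmxA Fv mulmx0.
Qed.

Lemma map_horner_polyC m n t (B : 'M[R]_(m, n)) :
  map_mx (horner_eval t \o polyC) B = B.
Proof. by apply/matrixP => i j; rewrite mxE /= /horner_eval hornerC. Qed.

(** Congruence by [G] carries the value at [t0] to the identity, because invertibility makes [G] a
    two-sided inverse of [F]. The squared Frobenius norm of the deviation from the identity is a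
    polynomial in [t], hence below 1 near [t0], and [psd_near1] applies. *)
Lemma psd_near k (M : 'M[{poly R}]_k) t0 :
    (forall t, (map_mx (horner_eval t) M)^T = map_mx (horner_eval t) M) ->
    psd (map_mx (horner_eval t0) M) -> map_mx (horner_eval t0) M \in unitmx ->
  exists2 c, 0 < c & forall t, `|t - t0| < c -> psd (map_mx (horner_eval t) M).
Proof.
move=> sM pM uM; have [r [F [G [ME FG]]]] := psd_factor pM.
have GF : G *m F = 1%:M.
  have E : map_mx (horner_eval t0) M *m (G *m F) = map_mx (horner_eval t0) M.
    by rewrite ME mulmxA -[F^T *m F *m G]mulmxA FG mulmx1.
  by rewrite -(mulKmx uM (G *m F)) E mulVmx.
pose N := map_mx polyC G^T *m M *m map_mx polyC G - 1%:M.
have NE t : map_mx (horner_eval t) N = G^T *m map_mx (horner_eval t) M *m G - 1%:M.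
  rewrite /N map_mxB !map_mxM map_mx1 -!map_mx_comp.
  by rewrite !map_horner_polyC.
have N0 : map_mx (horner_eval t0) N = 0.
  rewrite NE ME mulmxA -[G^T *m F^T *m F *m G]mulmxA FG mulmx1 -trmx_mul FG trmx1.
  by rewrite subrr.
clearbody N; pose q := \sum_i \sum_j N i j ^+ 2.
have qE t : q.[t] = \sum_i \sum_j (map_mx (horner_eval t) N) i j ^+ 2.
  rewrite horner_sum; apply: eq_bigr => i _; rewrite horner_sum.
  by apply: eq_bigr => j _; rewrite horner_exp [map_mx _ _ _ _]mxE.
have [c c0 Hc] := poly_cont t0 q ltr01.
exists c => // t /Hc; rewrite (qE t0) N0.
rewrite [X in _ - X]big1 => [|i _]; last first.
  by apply: big1 => j _; rewrite mxE expr0n.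
rewrite subr0 qE => /ltW/(le_trans (ler_norm _)) H.
have pN : psd (1%:M + map_mx (horner_eval t) N).
  apply: psd_near1 => //.
  by rewrite NE [LHS]linearB /= trmx1 !trmx_mul trmxK sM mulmxA.
have := psd_congr F pN; rewrite NE addrC subrK.
have -> : F^T *m (G^T *m map_mx (horner_eval t) M *m G) *m F =
    (G *m F)^T *m map_mx (horner_eval t) M *m (G *m F).
  by rewrite trmx_mul !mulmxA.
by rewrite GF trmx1 mul1mx mulmx1.
Qed.

End PositiveSemidefinite.

(** * A finite-dimensional Hahn-Banach theorem for cones *)

Section ConeFunctional.
Variables (R : realType) (I : finType).
Implicit Types (u v w : {ffun I -> R}).

(** The third hypothesis makes [e] an order unit, which keeps every one-step extension bounded; the
    fourth gives positivity on the line through [e], where the extension starts. *)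
Lemma cone_functional (Q : {ffun I -> R} -> Prop) (e : {ffun I -> R}) :
    (forall u v, Q u -> Q v -> Q (u + v)) ->
    (forall a u, 0 < a -> Q u -> Q (a *: u)) ->
    (forall w, exists2 c, 0 < c & Q (e + c *: w)) ->
    ~ Q (- e) ->
  exists f : {ffun I -> R}, \sum_i f i * e i = 1 /\
    forall u, Q u -> 0 <= \sum_i f i * u i.
Proof.
move=> QD QZ Qe QNe.
have Q0e t : 0 < t -> Q (t *: e).
  move=> t0; have [c c0 H] := Qe 0.
  by apply: QZ => //; rewrite scaler0 addr0 in H.
(* The functional is extended one coordinate at a time from the line through
   [e]; the coefficient of [e] is kept apart so that no basis containing [e]
   has to be chosen. *)
have ext (s : seq I) : exists f : {ffun I -> R}, forall t w,
    (forall i, i \notin s -> w i = 0) -> Q (t *: e + w) ->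
    0 <= t + \sum_i f i * w i.
  elim: s => [|b s [f IH]].
    exists 0 => t w w0; have -> : w = 0 by apply/ffunP => i; rewrite w0 ?ffunE.
    rewrite addr0 big1 ?addr0 => [Qt|i _]; last by rewrite ffunE mul0r.
    rewrite leNgt; apply/negP => t0; apply: QNe.
    have := QZ (- t^-1) _ _ Qt; rewrite oppr_gt0 invr_lt0 => /(_ t0).
    by rewrite scalerA mulNr mulVf ?lt_eqF // scaleN1r.
  have [bs|bs] := boolP (b \in s).
    exists f => t w w0; apply: IH => i; move: (w0 i); rewrite inE.
    by case: eqP => [->|_] //=; rewrite bs.
  pose d : {ffun I -> R} := [ffun i => (i == b)%:R].
  pose supp (w : {ffun I -> R}) := forall i, i \notin s -> w i = 0.
  pose g (t : R) (w : {ffun I -> R}) := t + \sum_i f i * w i.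
  (* [S] is the set of lower bounds that [Q] imposes on the new coefficient. By [key], each is at
     most every upper bound, so the supremum is an admissible value. *)
  pose S : set R := [set x : R | exists t w, [/\ supp w, Q (t *: e + w + d) & x = - g t w]].
  have gD t1 w1 t2 w2 : g t1 w1 + g t2 w2 = g (t1 + t2) (w1 + w2).
    rewrite /g addrACA -big_split /=; congr (_ + _); apply: eq_bigr => i _.
    by rewrite ffunE mulrDr.
  have gZ a t1 w1 : g (a * t1) (a *: w1) = a * g t1 w1.
    rewrite /g mulrDr mulr_sumr; congr (_ + _); apply: eq_bigr => i _.
    by rewrite ffunE mulrCA.
  have key t1 w1 t2 w2 : supp w1 -> supp w2 -> Q (t1 *: e + w1 + d) ->
      Q (t2 *: e + w2 - d) -> - g t1 w1 <= g t2 w2.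
    move=> s1 s2 Q1 Q2; rewrite -subr_ge0 opprK addrC gD; apply: IH.
      by move=> i si; rewrite ffunE s1 // s2 // addr0.
    have := QD _ _ Q1 Q2; rewrite addrACA subrr addr0.
    by rewrite addrACA -scalerDl.
  have [c1 c10 Q1] := Qe d; have [c2 c20 Q2] := Qe (- d).
  have s0 : supp 0 by move=> i _; rewrite ffunE.
  have Q1' : Q (c1^-1 *: e + 0 + d).
    have := QZ c1^-1 _ _ Q1; rewrite invr_gt0 => /(_ c10).
    by rewrite scalerDr scalerA mulVf ?gt_eqF // scale1r addr0.
  have Q2' : Q (c2^-1 *: e + 0 - d).
    have := QZ c2^-1 _ _ Q2; rewrite invr_gt0 => /(_ c20).
    by rewrite scalerDr scalerA mulVf ?gt_eqF // scale1r addr0.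
  have supS : has_sup S.
    split; first by exists (- g c1^-1 0), c1^-1, 0.
    exists (g c2^-1 0) => _ [t [w [sw Qw ->]]].
    exact: key.
  pose f' : {ffun I -> R} := [ffun i => if i == b then sup S else f i].
  exists f' => t w w0 Qw.
  pose w' : {ffun I -> R} := [ffun i => if i == b then 0 else w i].
  have sw' : supp w'.
    move=> i si; rewrite ffunE; case: (eqVneq i b) => // ib.
    by rewrite w0 // inE negb_or ib.
  have wE : w = w' + w b *: d.
    apply/ffunP => i; rewrite !ffunE; case: eqP => [->|_].
      by rewrite add0r [_ *: _]mulr1.
    by rewrite scaler0 addr0.
  have -> : t + \sum_i f' i * w i = g t w' + w b * sup S.
    rewrite /g -addrA; congr (_ + _).
    rewrite (bigD1 b) //= [in RHS](bigD1 b) //= !ffunE eqxx mulr0 add0r addrC.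
    rewrite [w b * _]mulrC; congr (_ + _); apply: eq_bigr => i ib.
    by rewrite !ffunE (negPf ib).
  rewrite wE addrA in Qw.
  (* Rescaling brings the coefficient of [d] to -1 or 1, giving an upper or a lower bound; at 0 the
     earlier functional suffices. *)
  have [wb0|wb0|wb0] := ltgtP (w b) 0.
  - have n0 : 0 < - (w b)^-1 by rewrite oppr_gt0 invr_lt0.
    have := QZ _ _ n0 Qw.
    rewrite !scalerDr !scalerA [_ * w b]mulNr mulVf ?lt_eqF // scaleN1r => Qw'.
    have : sup S <= g (- (w b)^-1 * t) (- (w b)^-1 *: w').
      apply: ge_sup; first exact: supS.1.
      move=> _ [t1 [w1 [s1 Q3 ->]]]; apply: key => //.
      by move=> i si; rewrite ffunE sw' // scaler0.
    rewrite gZ -(ler_nM2l wb0) mulrA mulrN mulfV ?lt_eqF // mulN1r.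
    by rewrite -subr_ge0 opprK addrC.
  - have n0 : 0 < (w b)^-1 by rewrite invr_gt0.
    have := QZ _ _ n0 Qw.
    rewrite !scalerDr !scalerA mulVf ?gt_eqF // scale1r => Qw'.
    have : - g ((w b)^-1 * t) ((w b)^-1 *: w') <= sup S.
      apply: ub_le_sup; first exact: supS.2.
      do 2 eexists; split; [|exact: Qw'|by []].
      by move=> i si; rewrite ffunE sw' // scaler0.
    rewrite gZ -(ler_pM2l wb0) mulrN mulrA mulfV ?gt_eqF // mul1r.
    by rewrite -subr_ge0 opprK addrC.
  - move: Qw; rewrite wb0 scale0r addr0 mul0r addr0 => Qw.
    exact: IH.
have [f Hf] := ext (enum I).
have sE w i : i \notin enum I -> w i = 0 by rewrite mem_enum.
have fe : \sum_i f i * e i = 1.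
  set x := \sum_i _.
  (* The point t e is also (t + r) e plus the vector - r e written in coordinates, so the inequality
     holds for every r; this is possible only if x = 1. *)
  have H t r : 0 < t -> 0 <= t + r * (1 - x).
    move=> t0; have := Hf (t + r) (- r *: e) (sE _).
    rewrite scalerDl scaleNr addrK => /(_ (Q0e _ t0)).
    suff -> : \sum_i f i * (- (r *: e)) i = - (r * x).
      by rewrite mulrBr mulr1 addrA.
    rewrite mulr_sumr -sumrN; apply: eq_bigr => i _.
    by rewrite !ffunE mulrN mulrCA.
  have [//|x1] := eqVneq x 1.
  have := H 1 (- 2 / (1 - x)) ltr01.
  rewrite mulfVK ?subr_eq0 1?eq_sym //; lra.
exists f; split=> // u Qu.
have := Hf 0 u (sE _); rewrite scale0r !add0r; exact.
Qed.

End ConeFunctional.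

(** * Gram data of matrix tuples and their pairing with pencils *)

Section MonicPencils.
Variables (R : realType) (g : nat).
Hypothesis hg : (0 < g)%N.

(* [None] indexes the constant monomial and [Some j] the variable x_j. *)
Definition ext n (X : 'I_g -> 'M[R]_n) (a : option 'I_g) : 'M[R]_n :=
  if a is Some j then X j else 1%:M.

Definition gram n k (X : 'I_g -> 'M[R]_n) (C : 'M[R]_(n, k)) (a : option 'I_g) :=
  C^T *m ext X a *m C.

Definition dsum n1 n2 (X1 : 'I_g -> 'M[R]_n1) (X2 : 'I_g -> 'M[R]_n2) :
    'I_g -> 'M[R]_(n1 + n2) :=
  fun j => block_mx (X1 j) 0 0 (X2 j).

(** For symmetric [T] and Gram data of [(X, C)], this is the quadratic form of the sum of T_a (x)
    X_a, with X_None = I, at the vector having the columns of [C] as blocks. *)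
Definition mxpair k (T E : option 'I_g -> 'M[R]_k) : R :=
  \sum_a \tr (T a *m E a).

Definition pencil k (A : 'I_g -> 'M[R]_k) (a : option 'I_g) : 'M[R]_k :=
  if a is Some j then - A j else 1%:M.

Lemma gram_dsum n1 n2 k (X1 : 'I_g -> 'M[R]_n1) (X2 : 'I_g -> 'M[R]_n2)
    (C1 : 'M[R]_(n1, k)) (C2 : 'M[R]_(n2, k)) a :
  gram (dsum X1 X2) (col_mx C1 C2) a = gram X1 C1 a + gram X2 C2 a.
Proof.
rewrite /gram; have -> : ext (dsum X1 X2) a = block_mx (ext X1 a) 0 0 (ext X2 a).
  by case: a => //=; rewrite -scalar_mx_block.
by rewrite tr_col_mx mul_row_block !mulmx0 addr0 add0r mul_row_col.
Qed.

Lemma gram_mulr n k r (X : 'I_g -> 'M[R]_n) (C : 'M[R]_(n, k)) (P : 'M[R]_(k, r)) a :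
  gram X (C *m P) a = P^T *m gram X C a *m P.
Proof. by rewrite /gram trmx_mul !mulmxA. Qed.

Lemma gramZ n k (X : 'I_g -> 'M[R]_n) (C : 'M[R]_(n, k)) c a :
  gram X (c *: C) a = (c ^+ 2) *: gram X C a.
Proof.
by rewrite /gram [(_ *: _)^T]linearZ /= -!scalemxAl -scalemxAr scalerA.
Qed.

Lemma gram_sym n k (X : 'I_g -> 'M[R]_n) (C : 'M[R]_(n, k)) a :
  symmetric_tuples X -> (gram X C a)^T = gram X C a.
Proof.
move=> sX; rewrite /gram !trmx_mul trmxK mulmxA.
by case: a => [j|] /=; rewrite ?sX ?trmx1.
Qed.

Lemma mxpair_congr n k r (T : option 'I_g -> 'M[R]_r) (P : 'M[R]_(r, k))
    (X : 'I_g -> 'M[R]_n) (C : 'M[R]_(n, k)) :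
  mxpair (fun a => P^T *m T a *m P) (gram X C) = mxpair T (gram X (C *m P^T)).
Proof.
apply: eq_bigr => a _; rewrite gram_mulr trmxK.
by rewrite -mulmxA -mulmxA mxtrace_mulC !mulmxA.
Qed.

Lemma mxpair_block n k1 k2 (A1 : 'I_g -> 'M[R]_k1) (A2 : 'I_g -> 'M[R]_k2)
    (X : 'I_g -> 'M[R]_n) (C1 : 'M[R]_(n, k1)) (C2 : 'M[R]_(n, k2)) :
  mxpair (pencil (dsum A1 A2)) (gram X (row_mx C1 C2)) =
  mxpair (pencil A1) (gram X C1) + mxpair (pencil A2) (gram X C2).
Proof.
rewrite /mxpair -big_split /=; apply: eq_bigr => a _.
have -> : pencil (dsum A1 A2) a = block_mx (pencil A1 a) 0 0 (pencil A2 a).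
  case: a => [j|] /=; last by rewrite -scalar_mx_block.
  by rewrite opp_block_mx !oppr0.
rewrite /gram tr_row_mx [col_mx C1^T _ *m _]mul_col_mx mul_col_row mulmx_block mxtrace_block.
by rewrite !mul0mx addr0 add0r.
Qed.

Lemma mxpairC0 n k (T : option 'I_g -> 'M[R]_k) (X : 'I_g -> 'M[R]_n) :
  mxpair T (gram X 0) = 0.
Proof. by apply: big1 => a _; rewrite /gram mulmx0 mulmx0 linear0. Qed.

(** * Separating two cones of Gram data by a monic pencil *)

Section Separation.
Variable D : forall n, ('I_g -> 'M[R]_n) -> Prop.
Hypothesis D_sym : forall n (X : 'I_g -> 'M[R]_n), D X -> symmetric_tuples X.
Hypothesis D_dsum : forall n1 n2 (X1 : 'I_g -> 'M[R]_n1) (X2 : 'I_g -> 'M[R]_n2),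
  D X1 -> D X2 -> D (dsum X1 X2).
Hypothesis D_absorbing : forall n (X : 'I_g -> 'M[R]_n), symmetric_tuples X ->
  exists2 c, 0 < c & forall s, 0 <= s <= c -> D (fun j => s *: X j).

Definition gram_cone k (E : option 'I_g -> 'M[R]_k) : Prop :=
  exists n (Y : 'I_g -> 'M[R]_n) (C : 'M[R]_(n, k)),
    D Y /\ forall a, E a = gram Y C a.

Lemma gram_coneD k (E1 E2 : option 'I_g -> 'M[R]_k) :
  gram_cone E1 -> gram_cone E2 -> gram_cone (fun a => E1 a + E2 a).
Proof.
move=> [n1 [Y1 [C1 [D1 H1]]]] [n2 [Y2 [C2 [D2 H2]]]].
exists (n1 + n2)%N, (dsum Y1 Y2), (col_mx C1 C2); split; first exact: D_dsum.
by move=> a; rewrite gram_dsum H1 H2.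
Qed.

Lemma gram_coneZ k (E : option 'I_g -> 'M[R]_k) c :
  0 <= c -> gram_cone E -> gram_cone (fun a => c *: E a).
Proof.
move=> c0 [n [Y [C [DY H]]]]; exists n, Y, (Num.sqrt c *: C); split=> // a.
by rewrite gramZ sqr_sqrtr // H.
Qed.

Lemma D_zero n : D (fun j : 'I_g => 0 : 'M[R]_n).
Proof.
have [c c0 H] := D_absorbing (X := fun j : 'I_g => 0 : 'M[R]_n) (fun j => trmx0 _ _ _).
have := H 0; rewrite lexx ltW // => /(_ isT).
by under eq_fun do rewrite scaler0.
Qed.

Lemma gram_cone_psd k (S : 'M[R]_k) : psd S ->
  gram_cone (fun a => if a is None then S else 0).
Proof.
move=> /psd_factor[r [F [_ [SE _]]]].
exists r, (fun j => 0), F; split; first exact: D_zero.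
by case=> [j|]; rewrite /gram /= ?mulmx0 ?mul0mx ?mulmx1.
Qed.

(** [cone_functional] is applied to the difference of the cone of [D] and the cone of [F], with the
    constant matrix I as order unit. The functional found there is symmetrized into [T]. *)
Lemma separation k (F : forall n, ('I_g -> 'M[R]_n) -> 'M[R]_(n, k) -> Prop) :
    (0 < k)%N ->
    (forall n (X : 'I_g -> 'M[R]_n) P, F n X P -> symmetric_tuples X) ->
    (forall n1 n2 (X1 : 'I_g -> 'M[R]_n1) (X2 : 'I_g -> 'M[R]_n2) P1 P2,
       F _ X1 P1 -> F _ X2 P2 -> F _ (dsum X1 X2) (col_mx P1 P2)) ->
    (forall n (X : 'I_g -> 'M[R]_n) P c, 0 < c -> F _ X P -> F _ X (c *: P)) ->
    (forall n (X : 'I_g -> 'M[R]_n) P, F _ X P -> ~ gram_cone (gram X P)) ->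
  exists T : option 'I_g -> 'M[R]_k,
  [/\ forall a, (T a)^T = T a,
      T None != 0,
      forall n (Y : 'I_g -> 'M[R]_n) C, D Y -> 0 <= mxpair T (gram Y C) &
      forall n (X : 'I_g -> 'M[R]_n) P, F _ X P -> mxpair T (gram X P) <= 0].
Proof.
move=> k0 Fsym FD FZ Fdis.
pose I : finType := (option 'I_g * 'I_k * 'I_k)%type.
pose mat (w : {ffun I -> R}) a : 'M[R]_k := \matrix_(i, j) w (a, i, j).
pose unmat (E : option 'I_g -> 'M[R]_k) : {ffun I -> R} :=
  [ffun x => E x.1.1 x.1.2 x.2].
have unmatK E a : mat (unmat E) a = E a by apply/matrixP => i j; rewrite !mxE ffunE.
have matD u v a : mat (u + v) a = mat u a + mat v a.
  by apply/matrixP => i j; rewrite !mxE ffunE.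
have matZ c u a : mat (c *: u) a = c *: mat u a.
  by apply/matrixP => i j; rewrite !mxE ffunE.
have matN u a : mat (- u) a = - mat u a.
  by apply/matrixP => i j; rewrite !mxE ffunE.
(* Zero data is adjoined, since [F] need not contain a pair whose Gram data is zero. *)
pose KK (E : option 'I_g -> 'M[R]_k) := (forall a, E a = 0) \/
  exists n (X : 'I_g -> 'M[R]_n) P, F n X P /\ forall a, E a = gram X P a.
have KKD E1 E2 : KK E1 -> KK E2 -> KK (fun a => E1 a + E2 a).
  case=> [H1|[n1 [X1 [P1 [F1 H1]]]]] [H2|[n2 [X2 [P2 [F2 H2]]]]].
  - by left=> a; rewrite H1 H2 addr0.
  - by right; exists n2, X2, P2; split=> // a; rewrite H1 H2 add0r.
  - by right; exists n1, X1, P1; split=> // a; rewrite H1 H2 addr0.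
  - right; exists (n1 + n2)%N, (dsum X1 X2), (col_mx P1 P2); split; first exact: FD.
    by move=> a; rewrite gram_dsum H1 H2.
have KKZ c E : 0 < c -> KK E -> KK (fun a => c *: E a).
  move=> c0 [H|[n [X [P [FX H]]]]]; first by left=> a; rewrite H scaler0.
  right; exists n, X, (Num.sqrt c *: P); split; first by apply: FZ; rewrite ?sqrtr_gt0.
  by move=> a; rewrite gramZ sqr_sqrtr ?ltW // H.
(* [Q] is invariant under adding antisymmetric matrices, so that [e] is an order
   unit for all matrices and not only for the symmetric ones. *)
pose Q w := exists E, KK E /\
  gram_cone (fun a => mat w a + (mat w a)^T + E a).
have coneE (E E' : option 'I_g -> 'M[R]_k) : E =1 E' -> gram_cone E -> gram_cone E'.
  by move=> H [n [Y [C [DY HE]]]]; exists n, Y, C; split=> // a; rewrite -H.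
pose e := unmat (fun a => if a is None then 1%:M else 0).
have cone2 : gram_cone (fun a => if a is None then 2%:M else 0 : 'M[R]_k).
  apply: gram_cone_psd; split; first exact: tr_scalar_mx.
  move=> v; rewrite mul_mx_scalar -scalemxAl mxE mulr_ge0 // mxE.
  by apply: sumr_ge0 => i _; rewrite mxE -expr2 sqr_ge0.
have KK0 : KK (fun=> 0) by left.
have [||||f [fe fQ]] := @cone_functional R I Q e.
- move=> u v [E1 [K1 C1]] [E2 [K2 C2]]; exists (fun a => E1 a + E2 a).
  split; first exact: KKD.
  apply: coneE (gram_coneD C1 C2) => a.
  by rewrite matD [(_ + _)^T]linearD /= addrACA; congr (_ + _); rewrite addrACA.
- move=> c u c0 [E [KE CE]]; exists (fun a => c *: E a); split; first exact: KKZ.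
  apply: coneE (gram_coneZ (ltW c0) CE) => a.
  by rewrite matZ [(_ *: _)^T]linearZ /= !scalerDr.
(* The symmetrized e + c w splits into constant data I + c W_None, positive semidefinite for small
   [c], and the Gram data of the tuple c W_j with factor I. *)
- move=> w; pose W a := mat w a + (mat w a)^T.
  have sW a : (W a)^T = W a by rewrite /W [LHS]linearD /= trmxK addrC.
  have [c1 c10 H1] := @psd_absorb R k (W None) (sW _).
  have [c2 c20 H2] := D_absorbing (X := fun j => W (Some j)) (fun j => sW _).
  pose c := Num.min c1 c2.
  have c0 : 0 < c by rewrite lt_min c10.
  exists c => //; exists (fun=> 0); split=> //.
  have C1 : gram_cone (fun a => if a is None then 1%:M + c *: W None else 0).
    by apply/gram_cone_psd/H1; rewrite ltW //= ge_min lexx.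
  have C2 : gram_cone (fun a => if a is Some j then c *: W (Some j) else 1%:M).
    exists k, (fun j => c *: W (Some j)), 1%:M; split.
      by apply: H2; rewrite ltW //= ge_min lexx orbT.
    by case=> [j|]; rewrite /gram /= trmx1 !mul1mx ?mulmx1.
  apply: coneE (gram_coneD C1 C2) => a.
  rewrite addr0 matD matZ unmatK [(_ + _)^T]linearD /= [(_ *: _)^T]linearZ /=.
  rewrite addrACA -scalerDr -/(W a); case: a => [j|]; first by rewrite trmx0 addr0 !add0r.
  by rewrite trmx1 addrAC.
(* Adding 2 I in the constant slot cancels the contribution of - e, so [E] itself lies in the cone
   of [D]. *)
- move=> [E [KE CE]].
  have : gram_cone E.
    apply: coneE (gram_coneD cone2 CE) => a; rewrite matN unmatK.
    rewrite [(- _)^T]linearN /= addrA -[RHS]add0r; congr (_ + _).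
    case: a => [j|]; first by rewrite trmx0 oppr0 !addr0.
    by apply/matrixP => i j; rewrite trmx1 !mxE; case: (i == j); rewrite ?mulr1n ?mulr0n; lra.
  (* Nonzero [E] contradicts [Fdis]. For [E] = 0 the cone contains data with constant part - 2 I,
     whose diagonal would be a sum of squares; [k0] provides a diagonal entry. *)
  case: KE => [E0|[n [X [P [FX EE]]]]]; last first.
    by move=> /(coneE _ _ EE); apply: Fdis FX.
  move=> CE0; have := CE => -[n [Y [C [DY /(_ None)]]]].
  rewrite matN unmatK E0 addr0 /gram /= mulmx1 [(- _)^T]linearN /= trmx1.
  move/matrixP/(_ (Ordinal k0) (Ordinal k0)); rewrite !mxE eqxx => H.
  have : 0 <= - 1 - 1 :> R.
    by rewrite H; apply: sumr_ge0 => i _; rewrite mxE -expr2 sqr_ge0.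
  lra.
(* On symmetric data the symmetrized matrices pair as [f] does. *)
pose T a : 'M[R]_k := 2^-1 *: (mat f a + (mat f a)^T).
have sT a : (T a)^T = T a.
  by rewrite /T [LHS]linearZ /= [(_ + _)^T]linearD /= trmxK addrC.
have pT (E : option 'I_g -> 'M[R]_k) : (forall a, (E a)^T = E a) ->
    mxpair T E = \sum_x f x * unmat E x.
  move=> sE; rewrite (eq_bigr (fun x => f (x.1, x.2) * unmat E (x.1, x.2))); last by case.
  rewrite -(pair_bigA _ (fun x1 x2 => f (x1, x2) * unmat E (x1, x2))) /=.
  rewrite (eq_bigr (fun x => \sum_j f (x.1, x.2, j) * unmat E (x.1, x.2, j))); last by case.
  rewrite -(pair_bigA _ (fun x1 x2 => \sum_j f (x1, x2, j) * unmat E (x1, x2, j))) /=.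
  apply: eq_bigr => a _.
  have -> : \tr (T a *m E a) = \tr (mat f a *m E a).
    rewrite /T -scalemxAl mulmxDl linearZ /= linearD /=.
    rewrite -[X in _ + X]mxtrace_tr trmx_mul trmxK sE [in X in _ + X]mxtrace_mulC.
    by set x := \tr _; lra.
  apply: eq_bigr => i _; rewrite mxE; apply: eq_bigr => j _.
  by rewrite mxE ffunE /= -[in LHS]sE mxE.
clearbody T; exists T; split=> //.
- have : mxpair T (fun a => if a is None then 1%:M else 0) = 1.
    by rewrite pT // => -[j|]; rewrite ?trmx0 ?trmx1.
  move=> T1; apply/negP => /eqP T0.
  have : mxpair T (fun a => if a is None then 1%:M else 0) = 0.
    apply: big1 => -[j|] _; first by rewrite mulmx0 linear0.
    by rewrite T0 mul0mx linear0.
  by rewrite T1 => /eqP; rewrite oner_eq0.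
- move=> n Y C DY; rewrite pT; last by move=> a; apply/gram_sym/D_sym.
  apply: fQ; exists (fun=> 0); split=> //.
  have CY : gram_cone (gram Y C) by exists n, Y, C.
  apply: coneE (gram_coneD CY CY) => a.
  by rewrite unmatK addr0 gram_sym //; exact: D_sym.
- move=> n X P FX; have sX := Fsym _ _ _ FX; rewrite pT; last by move=> a; exact: gram_sym.
  have KX : KK (gram X P) by right; exists n, X, P.
  have NE (u : {ffun I -> R}) x : (- u) x = - u x by rewrite ffunE.
  have := fQ (- unmat (gram X P)).
  set s := \sum_i _; set s' := \sum_i _; have -> : s = - s'.
    by rewrite /s /s' -sumrN; apply: eq_bigr => i _; rewrite NE mulrN.
  rewrite oppr_ge0; apply.
  (* Twice the data of [F] cancels the symmetrization of its negative, leaving zero data. *)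
  exists (fun a => gram X P a + gram X P a); split; first exact: KKD.
  have : gram_cone (fun a => 0 : 'M[R]_k).
    exists 0%N, (fun=> 0), 0; split; first exact: D_zero.
    by move=> a; rewrite /gram mulmx0.
  apply: coneE => a.
  by rewrite matN unmatK [(- _)^T]linearN /= gram_sym // -opprD addNr.
Qed.

(** Positivity is tested on 1 x 1 tuples in which only the variable [j] is nonzero, equal to a small
    number of either sign. *)
Lemma psd_mxpair k (T : option 'I_g -> 'M[R]_k) :
    (forall a, (T a)^T = T a) ->
    (forall n (Y : 'I_g -> 'M[R]_n) C, D Y -> 0 <= mxpair T (gram Y C)) ->
  forall j, exists2 s, 0 < s &
    psd (T None + s *: T (Some j)) /\ psd (T None - s *: T (Some j)).
Proof.
move=> sT pT j.
have H (y : R) : exists2 c, 0 < c & forall s, 0 <= s <= c ->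
    psd (T None + (s * y) *: T (Some j)).
  have [i|c c0 Hc] := D_absorbing (X := fun i => if i == j then y%:M else 0 : 'M[R]_1).
    by case: ifP; rewrite ?tr_scalar_mx ?trmx0.
  exists c => // s /Hc Ds; split.
    by rewrite [LHS]linearD /= [(_ *: _)^T]linearZ /= !sT.
  move=> v; have := pT _ _ v^T Ds.
  rewrite /mxpair (bigD1 None) //= (bigD1 (Some j)) //= big1 ?addr0; last first.
    case=> // i /andP[_ ij]; rewrite /gram /=.
    have -> : (i == j) = false by apply: contraNF ij => /eqP ->.
    by rewrite scaler0 mulmx0 mul0mx mulmx0 linear0.
  rewrite /gram /= eqxx trmxK mulmx1 scale_scalar_mx mul_mx_scalar -scalemxAl -scalemxAr.
  rewrite mulmxDr mulmxDl -scalemxAr -scalemxAl.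
  have trE (M : 'M[R]_k) : \tr (M *m (v *m v^T)) = (v^T *m M *m v) 0 0.
    by rewrite mulmxA mxtrace_mulC mulmxA [LHS]big_ord1.
  rewrite linearZ /= !trE => H; rewrite mxE [X in _ + X]mxE.
  exact: H.
have [c1 c10 H1] := H 1; have [c2 c20 H2] := H (- 1).
exists (Num.min c1 c2); first by rewrite lt_min c10.
have c0 : 0 <= Num.min c1 c2 by rewrite le_min !ltW.
split; first by rewrite -[Num.min _ _]mulr1; apply: H1; rewrite c0 ge_min lexx.
by rewrite -scaleNr -mulrN1; apply: H2; rewrite c0 ge_min lexx orbT.
Qed.

(** On the kernel of the constant part, T_j and - T_j both have nonnegative form, so the form of T_j
    vanishes there. A null vector of the form of a positive semidefinite matrix lies in its
    kernel. *)
Lemma kernel_mxpair k (T : option 'I_g -> 'M[R]_k) r (N : 'M[R]_(k, r)) :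
    (forall a, (T a)^T = T a) ->
    (forall n (Y : 'I_g -> 'M[R]_n) C, D Y -> 0 <= mxpair T (gram Y C)) ->
  T None *m N = 0 -> forall a, T a *m N = 0.
Proof.
move=> sT pT TN; case=> // j.
have [s s0 [p1 p2]] := psd_mxpair sT pT j.
have NE (x : R) : N^T *m (T None + x *: T (Some j)) *m N = x *: (N^T *m T (Some j) *m N).
  by rewrite mulmxDr mulmxDl -mulmxA TN mulmx0 add0r -scalemxAr -scalemxAl.
pose Z := N^T *m T (Some j) *m N.
have Z0 : Z = 0.
  apply/eqP/negPn/negP => Zn0.
  have := psd_congr N p1; rewrite NE => q1.
  have := psd_congr N p2; rewrite -scaleNr NE -/Z => q2.
  have [|x x1] := psd_neq0 q1; first by rewrite scaler_eq0 negb_or gt_eqF.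
  have := q2.2 x; rewrite -/Z scaleNr mulmxN mulNmx mxE x1; lra.
have [r' [F [_ [ME _]]]] := psd_factor p1.
have FN : F *m N = 0.
  apply: mulmx_tr_eq0.
  by rewrite trmx_mul mulmxA -[_ *m _ *m F]mulmxA -ME NE -/Z Z0 scaler0.
have : (T None + s *: T (Some j)) *m N = 0 by rewrite ME -mulmxA FN mulmx0.
rewrite mulmxDl TN add0r -scalemxAl => /eqP.
by rewrite scaler_eq0 gt_eqF //= => /eqP.
Qed.

(** The constant part T_None = B^T B may be singular, so [T] is compressed by [G] to a monic pencil
    of size [r]. It decides only the pairs with P B^T nonzero; the others need k - r columns and are
    left to the induction, so the sizes add up to [k]. *)
Lemma separating_pencil k (F : forall n, ('I_g -> 'M[R]_n) -> 'M[R]_(n, k) -> Prop) :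
    (forall n (X : 'I_g -> 'M[R]_n) P, F n X P -> symmetric_tuples X) ->
    (forall n1 n2 (X1 : 'I_g -> 'M[R]_n1) (X2 : 'I_g -> 'M[R]_n2) P1 P2,
       F _ X1 P1 -> F _ X2 P2 -> F _ (dsum X1 X2) (col_mx P1 P2)) ->
    (forall n (X : 'I_g -> 'M[R]_n) P c, 0 < c -> F _ X P -> F _ X (c *: P)) ->
    (forall n (X : 'I_g -> 'M[R]_n) P, F _ X P -> ~ gram_cone (gram X P)) ->
  exists A : 'I_g -> 'M[R]_k,
  [/\ symmetric_tuples A,
      forall n (Y : 'I_g -> 'M[R]_n) C, D Y -> 0 <= mxpair (pencil A) (gram Y C) &
      forall n (X : 'I_g -> 'M[R]_n) P, F _ X P ->
        exists2 C : 'M[R]_(n, k), C != 0 & mxpair (pencil A) (gram X C) <= 0].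
Proof.
elim/ltn_ind: k F => k IHk F Fsym FD FZ Fdis.
have [k0|k0] := posnP k.
  (* Without columns all Gram data is equal and lies in the cone, so [Fdis] makes [F] empty. *)
  subst k; exists (fun=> 0); split=> //.
  - by move=> j; rewrite trmx0.
  - by move=> n Y C _; rewrite [C]thinmx0 mxpairC0.
  - move=> n X P FX; case: (Fdis _ _ _ FX); exists 0%N, (fun=> 0), 0.
    by split=> [|a]; [exact: D_zero | apply/matrixP => -[]].
have [T [sT T0 pT nT]] := separation k0 Fsym FD FZ Fdis.
(* T_None is the average of T_None + s T_j and T_None - s T_j for any single variable, which [hg]
   provides. *)
have pTN : psd (T None).
  have [s s0 [p1 p2]] := psd_mxpair sT pT (Ordinal hg).
  split=> // v; have := p1.2 v; have := p2.2 v.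
  rewrite !mulmxDr !mulmxDl -scaleNr -!scalemxAr -!scalemxAl.
  by rewrite !mxE; lra.
have [r [B [G [TE BG]]]] := psd_factor pTN.
(* The projection onto the kernel of T_None along the range of [G]. *)
pose N : 'M[R]_k := 1%:M - G *m B.
have TN a : T a *m N = 0.
  apply: kernel_mxpair => //; rewrite mulmxBr mulmx1 TE -[B^T *m B *m _]mulmxA.
  by rewrite [B *m _]mulmxA BG mul1mx subrr.
pose L a := G^T *m T a *m G.
have L1 : L None = 1%:M.
  rewrite /L TE mulmxA -[_ *m B *m G]mulmxA BG mulmx1 -trmx_mul BG trmx1 //.
have TL a : T a = B^T *m L a *m B.
  have E : T a *m (G *m B) = T a.
    by have := TN a; rewrite mulmxBr mulmx1 => /subr0_eq.
  have E' : (G *m B)^T *m T a = T a.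
    by rewrite -[LHS]trmxK trmx_mul trmxK sT E sT.
  by rewrite /L !mulmxA -trmx_mul E' -mulmxA E.
pose A1 j := - L (Some j).
have sA1 : symmetric_tuples A1.
  by move=> j; rewrite /A1 [LHS]linearN /= /L !trmx_mul trmxK sT mulmxA.
have A1E : pencil A1 = L.
  by apply/funext => -[j|] /=; rewrite ?L1 // /A1 opprK.
have r0 : (0 < r)%N.
  rewrite lt0n; apply: contra_neq T0 => r0; rewrite TE; subst r.
  by rewrite [B]flatmx0 mulmx0.
have rkN : (r + \rank N^T)%N = k.
  rewrite mxrank_tr; apply/eqP; rewrite eqn_leq; apply/andP; split.
    have rGB : (r <= \rank (G *m B))%N.
      rewrite -[X in (X <= _)%N](mxrank1 R) -BG -[B *m G]mul1mx -BG.
      have -> : B *m G *m (B *m G) = B *m (G *m B) *m G by rewrite !mulmxA.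
      by rewrite (leq_trans (mxrankM_maxl _ _)) // mxrankM_maxr.
    apply: leq_trans (leq_add rGB (leqnn _)) _.
    apply: mulmx0_rank_max; rewrite mulmxBr mulmx1 mulmxA -[G *m B *m G]mulmxA BG.
    by rewrite mulmx1 subrr.
  rewrite -[X in (X <= _)%N](mxrank1 R).
  have -> : 1%:M = G *m B + N by rewrite addrC subrK.
  apply: leq_trans (mxrank_add _ _) _; rewrite leq_add2r.
  by rewrite (leq_trans (mxrankM_maxr _ _)) // rank_leq_row.
(* A full-rank factorization N^T = H H': a matrix [P] with P B^T = 0 equals (P H) H', and P H has
   only k' columns. *)
have NH := mulmx_base N^T; set H := col_base _ in NH; set H' := row_base _ in NH.
set k' := \rank _ in rkN H H' NH.
have [|||||A2 [sA2 pA2 nA2]] := IHk k' _ (fun n X P => F n X (P *m H')).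
- by rewrite -rkN -[X in (X < _)%N]add0n ltn_add2r.
- by move=> n X P; exact: Fsym.
- by move=> n1 n2 X1 X2 P1 P2 F1 F2; rewrite mul_col_mx; exact: FD.
- by move=> n X P c c0 FX; rewrite -scalemxAl; exact: FZ.
- move=> n X P FX [n' [Y [C [DY E]]]]; apply: (Fdis _ _ _ FX).
  by exists n', Y, (C *m H'); split=> // a; rewrite !gram_mulr E.
have nT' n (X : 'I_g -> 'M[R]_n) P : F n X P ->
    exists2 C : 'M[R]_(n, r + k'), C != 0 & mxpair (pencil (dsum A1 A2)) (gram X C) <= 0.
  move=> FX; have [PB|PB] := eqVneq (P *m B^T) 0.
    have PE : P = P *m H *m H'.
      rewrite -mulmxA NH /N [(_ - _)^T]linearB /= trmx1 trmx_mul mulmxBr mulmx1.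
      by rewrite mulmxA PB mul0mx subr0.
    have [|C C0 qC] := nA2 n X (P *m H); first by rewrite -PE.
    exists (row_mx 0 C); last by rewrite mxpair_block mxpairC0 add0r.
    apply: contra_neq C0 => /(congr1 rsubmx); rewrite row_mxKr => ->.
    by apply/matrixP => i j; rewrite !mxE.
  exists (row_mx (P *m B^T) 0); last first.
    rewrite mxpair_block mxpairC0 addr0 A1E -mxpair_congr.
    by rewrite (_ : (fun a => _) = T) ?nT //; apply/funext => a; rewrite -TL.
  apply: contra_neq PB => /(congr1 lsubmx); rewrite row_mxKl => ->.
  by apply/matrixP => i j; rewrite !mxE.
have pT' n (Y : 'I_g -> 'M[R]_n) (C : 'M[R]_(n, r + k')) : D Y ->
    0 <= mxpair (pencil (dsum A1 A2)) (gram Y C).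
  move=> DY; rewrite -[C]hsubmxK mxpair_block addr_ge0 ?pA2 // A1E.
  by have := pT _ Y (lsubmx C *m G^T) DY; rewrite -mxpair_congr.
have sA : symmetric_tuples (dsum A1 A2).
  by move=> j; rewrite /dsum tr_block_mx sA1 sA2 !trmx0.
move: (dsum A1 A2) nT' pT' sA; rewrite rkN => A nT' pT' sA.
by exists A; split=> // n X P /nT'.
Qed.

End Separation.
End MonicPencils.

(** * Tensor vectors as rectangular matrices *)

Section VectorsAsMatrices.
Variable R : realType.

Lemma unitmx_inj_cV n (M : 'M[R]_n) :
  M \in unitmx <-> forall v : 'cV[R]_n, M *m v = 0 -> v = 0.
Proof.
split=> [uM v Mv|H]; first by rewrite -(mulKmx uM v) Mv mulmx0.
rewrite -unitmx_tr -row_free_unit; apply: inj_row_free => v vM.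
apply: trmx_inj; rewrite trmx0; apply: H.
by apply: trmx_inj; rewrite trmx_mul trmxK vM trmx0.
Qed.

Variables (d n : nat).

(* The vector [\sum_i e_i *t v_i] of R^d (x) R^n as the n x d matrix with
   columns [v_i]. *)
Definition unvec (v : 'cV[R]_(d * n)) : 'M[R]_(n, d) :=
  \matrix_(a, i) v (mxtens_index (i, a)) 0.

Lemma unvec_inj : injective unvec.
Proof.
move=> u v /matrixP H; apply/matrixP => k j; rewrite ord1.
by case: (mxtens_indexP k) => i a; have := H a i; rewrite !mxE.
Qed.

Lemma unvec0 : unvec 0 = 0.
Proof. by apply/matrixP => i j; rewrite !mxE. Qed.

Lemma unvec_eq0 v : (unvec v == 0) = (v == 0).
Proof. by rewrite -unvec0 (inj_eq unvec_inj). Qed.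

Lemma unvec_surj (C : 'M[R]_(n, d)) : exists v, unvec v = C.
Proof.
exists (\col_k C (mxtens_unindex k).2 (mxtens_unindex k).1).
by apply/matrixP => a i; rewrite !mxE mxtens_indexK.
Qed.

Lemma big_mxtens (f : 'I_(d * n) -> R) :
  \sum_k f k = \sum_i \sum_a f (mxtens_index (i, a)).
Proof.
rewrite pair_bigA /= (reindex (@mxtens_index d n)) /=; last first.
  by exists (@mxtens_unindex d n) => k _; rewrite (mxtens_indexK, mxtens_unindexK).
by apply: eq_bigr => -[].
Qed.

Lemma unvec_tens (A : 'M[R]_d) (B : 'M[R]_n) v :
  unvec ((A *t B) *m v) = B *m unvec v *m A^T.
Proof.
apply/matrixP => a i; rewrite !mxE big_mxtens; apply: eq_bigr => i' _.
rewrite !mxE mulr_suml; apply: eq_bigr => a' _.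
by rewrite tensmxE !mxE -mulrA mulrC.
Qed.

Lemma unvecD u v : unvec (u + v) = unvec u + unvec v.
Proof. by apply/matrixP => i j; rewrite !mxE. Qed.

Lemma unvec_dot u v : (u^T *m v) 0 0 = \tr ((unvec u)^T *m unvec v).
Proof.
rewrite mxE big_mxtens; apply: eq_bigr => i _.
by rewrite mxE; apply: eq_bigr => a _; rewrite !mxE.
Qed.

End VectorsAsMatrices.

(** * The domain along rays: direct sums, openness and compressions *)

Section Domain.
Variables (R : realType) (g delta : nat) (p : free_poly R g delta).

(** The operator p(X) transported by [unvec], under which A (x) B becomes C |-> B C A^T. *)
Definition pact n (X : 'I_g -> 'M[R]_n) (C : 'M[R]_(n, delta)) : 'M[R]_(n, delta) :=
  \sum_(w <- finsupp p) word_eval X w *m C *m (p w)^T.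

Lemma unvec_fp_eval n (X : 'I_g -> 'M[R]_n) v :
  unvec (fp_eval p X *m v) = pact X (unvec v).
Proof.
rewrite /fp_eval /pact mulmx_suml (big_morph _ (@unvecD _ _ _) (@unvec0 _ _ _)).
by apply: eq_bigr => w _; rewrite unvec_tens.
Qed.

Lemma fp_eval_unitP n (X : 'I_g -> 'M[R]_n) :
  fp_eval p X \in unitmx <-> forall C, pact X C = 0 -> C = 0.
Proof.
rewrite unitmx_inj_cV; split=> [H C XC|H v Xv].
  have [v vC] := unvec_surj C; rewrite -vC -(unvec0 R delta n); congr unvec; apply: H.
  by apply: unvec_inj; rewrite unvec_fp_eval vC XC unvec0.
apply: unvec_inj; rewrite unvec0; apply: H.
by rewrite -unvec_fp_eval Xv unvec0.
Qed.

Lemma word_eval_nil n (X : 'I_g -> 'M[R]_n) : word_eval X [::] = 1%:M.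
Proof. by rewrite /word_eval big_nil. Qed.

Lemma word_eval_cons n (X : 'I_g -> 'M[R]_n) j w :
  word_eval X (j :: w) = X j *m word_eval X w.
Proof. by rewrite /word_eval big_cons. Qed.

Lemma word_eval_cat n (X : 'I_g -> 'M[R]_n) u w :
  word_eval X (u ++ w) = word_eval X u *m word_eval X w.
Proof.
elim: u => [|j u IH]; first by rewrite word_eval_nil mul1mx.
by rewrite /= !word_eval_cons IH mulmxA.
Qed.

Lemma word_eval_tr n (X : 'I_g -> 'M[R]_n) w : symmetric_tuples X ->
  (word_eval X w)^T = word_eval X (rev w).
Proof.
move=> sX; elim: w => [|j w IH]; first by rewrite word_eval_nil trmx1.
rewrite word_eval_cons trmx_mul IH sX rev_cons -cats1 word_eval_cat.
by rewrite word_eval_cons word_eval_nil mulmx1.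
Qed.

Lemma word_evalZ n (X : 'I_g -> 'M[R]_n) t w :
  word_eval (fun j => t *: X j) w = t ^+ size w *: word_eval X w.
Proof.
elim: w => [|j w IH]; first by rewrite !word_eval_nil scale1r.
by rewrite !word_eval_cons IH -scalemxAl -scalemxAr scalerA exprS.
Qed.

Lemma word_eval_dsum n1 n2 (X1 : 'I_g -> 'M[R]_n1) (X2 : 'I_g -> 'M[R]_n2) w :
  word_eval (dsum X1 X2) w = block_mx (word_eval X1 w) 0 0 (word_eval X2 w).
Proof.
elim: w => [|j w IH]; first by rewrite !word_eval_nil -scalar_mx_block.
by rewrite !word_eval_cons IH mulmx_block !mulmx0 !mul0mx !addr0 !add0r.
Qed.

Lemma pact_dsum n1 n2 (X1 : 'I_g -> 'M[R]_n1) (X2 : 'I_g -> 'M[R]_n2) C1 C2 :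
  pact (dsum X1 X2) (col_mx C1 C2) = col_mx (pact X1 C1) (pact X2 C2).
Proof.
rewrite /pact; elim/big_rec3: _ => [|w y1 y2 y3 _ ->]; first by rewrite col_mx0.
rewrite word_eval_dsum mul_block_col !mul0mx addr0 add0r mul_col_mx.
by rewrite add_col_mx.
Qed.

Lemma pactZ n (X : 'I_g -> 'M[R]_n) c C : pact X (c *: C) = c *: pact X C.
Proof.
rewrite /pact scaler_sumr; apply: eq_bigr => w _.
by rewrite -scalemxAr -scalemxAl.
Qed.

Lemma pact_intertwine n m (X : 'I_g -> 'M[R]_n) (Y : 'I_g -> 'M[R]_m)
    (V : 'M[R]_(n, m)) C :
  (forall j, X j *m V = V *m Y j) -> pact X (V *m C) = V *m pact Y C.
Proof.
move=> XV; have wV w : word_eval X w *m V = V *m word_eval Y w.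
  elim: w => [|j w IH]; first by rewrite !word_eval_nil mul1mx mulmx1.
  by rewrite !word_eval_cons -mulmxA IH mulmxA XV mulmxA.
rewrite /pact mulmx_sumr; apply: eq_bigr => w _.
by rewrite mulmxA wV !mulmxA.
Qed.

Lemma fp_eval_poly n (X : 'I_g -> 'M[R]_n) :
  exists M : 'M[{poly R}]_(delta * n), forall t,
    fp_eval p (fun j => t *: X j) = map_mx (horner_eval t) M.
Proof.
exists (\sum_(w <- finsupp p) 'X^(size w) *: map_mx polyC (p w *t word_eval X w)) => t.
rewrite /fp_eval raddf_sum; apply: eq_bigr => w _.
apply/matrixP => i j; rewrite word_evalZ !mxE /= /horner_eval hornerM hornerXn hornerC.
by rewrite mulrCA.
Qed.

(* Equal to the component of 0 as soon as that component is convex. *)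
Definition segment_domain n (X : 'I_g -> 'M[R]_n) : Prop :=
  symmetric_tuples X /\
  forall t, 0 <= t <= 1 -> forall C, pact (fun j => t *: X j) C = 0 -> C = 0.

Lemma segment_domain_dsum n1 n2 (X1 : 'I_g -> 'M[R]_n1) (X2 : 'I_g -> 'M[R]_n2) :
  segment_domain X1 -> segment_domain X2 -> segment_domain (dsum X1 X2).
Proof.
move=> [s1 D1] [s2 D2]; split.
  by move=> j; rewrite /dsum tr_block_mx s1 s2 !trmx0.
move=> t t01 C.
have -> : (fun j => t *: dsum X1 X2 j) = dsum (fun j => t *: X1 j) (fun j => t *: X2 j).
  by apply/funext => j; rewrite /dsum scale_block_mx !scaler0.
rewrite -[C]vsubmxK pact_dsum -col_mx0 => /eq_col_mx[C1 C2].
by rewrite (D1 t t01 _ C1) (D2 t t01 _ C2).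
Qed.

Lemma segment_domain_conj n (X : 'I_g -> 'M[R]_n) (U : 'M[R]_n) :
  U^T *m U = 1%:M -> segment_domain X -> segment_domain (fun j => U^T *m X j *m U).
Proof.
move=> UU [sX DX]; have UU' := mulmx1C UU; split.
  by move=> j; rewrite !trmx_mul trmxK sX mulmxA.
move=> t t01 C HC; have /(DX t t01) : pact (fun j => t *: X j) (U *m C) = 0.
  rewrite (pact_intertwine (Y := fun j => t *: (U^T *m X j *m U))) ?HC ?mulmx0 // => j.
  by rewrite -scalemxAl -scalemxAr !mulmxA UU' mul1mx.
by move/(congr1 (mulmx U^T)); rewrite mulmxA UU mul1mx mulmx0.
Qed.

Lemma pact0X n (X : 'I_g -> 'M[R]_n) C :
  pact (fun j => 0 *: X j) C = C *m (p [::])^T.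
Proof.
have w0 w : w != [::] -> word_eval (fun j => 0 *: X j) w = 0.
  by case: w => // j w _; rewrite word_eval_cons scale0r mul0mx.
rewrite /pact; have [s0|s0] := boolP ([::] \in finsupp p).
  rewrite (bigD1_seq [::]) ?fset_uniq //= big1 => [|w /w0 ->]; last by rewrite !mul0mx.
  by rewrite word_eval_nil mul1mx addr0.
rewrite big_seq big1 => [|w ws]; first by rewrite fsfun_dflt // trmx0 mulmx0.
by rewrite w0 ?mul0mx //; apply: contraNneq s0 => <-.
Qed.

(** The determinant of p(tX) is a polynomial in [t], nonzero at [t0], hence nonzero nearby. *)
Lemma segment_domain_nbhs n (X : 'I_g -> 'M[R]_n) t0 :
    (forall C, pact (fun j => t0 *: X j) C = 0 -> C = 0) ->
  exists2 c, 0 < c & forall t, `|t - t0| < c ->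
    forall C, pact (fun j => t *: X j) C = 0 -> C = 0.
Proof.
have [M ME] := fp_eval_poly X; pose q := \det M => /fp_eval_unitP.
have qE t : q.[t] = \det (fp_eval p (fun j => t *: X j)).
  by rewrite ME det_map_mx.
rewrite unitmxE unitfE -qE => qt0.
have e0 : 0 < `|q.[t0]| by rewrite normr_gt0.
have [c c0 Hc] := poly_cont t0 q e0.
exists c => // t /Hc qt.
apply/fp_eval_unitP; rewrite unitmxE unitfE -qE.
by apply: contraTneq qt => ->; rewrite sub0r normrN ltxx.
Qed.

Hypothesis p0_unit : p [::] \in unitmx.

Lemma segment_domain_absorbing n (X : 'I_g -> 'M[R]_n) : symmetric_tuples X ->
  exists2 c, 0 < c & forall s, 0 <= s <= c -> segment_domain (fun j => s *: X j).
Proof.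
move=> sX; have [|c c0 Hc] := @segment_domain_nbhs n X 0.
  move=> C; rewrite pact0X => Cp.
  have uP : (p [::])^T \in unitmx by rewrite unitmx_tr.
  by rewrite -(mulmxK uP C) Cp mul0mx.
(* Halving turns the weak bound on s into the strict one that [Hc] requires. *)
exists (c / 2); first by rewrite divr_gt0.
move=> s /andP[s0 sc]; split; first by move=> j; rewrite [LHS]linearZ /= sX.
move=> t /andP[t0 t1] C; under [X in pact X _]eq_fun do rewrite scalerA.
apply: Hc; rewrite subr0 ger0_norm ?mulr_ge0 //.
have : t * s <= s by rewrite ler_piMl.
lra.
Qed.

(** Lets nonnegativity of a monic pencil at a slightly larger multiple of [X] be improved to strict
    positivity at [X]. *)
Lemma segment_domain_open n (X : 'I_g -> 'M[R]_n) : segment_domain X ->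
  exists2 c, 0 < c & segment_domain (fun j => (1 + c) *: X j).
Proof.
move=> [sX DX]; have [|c c0 Hc] := @segment_domain_nbhs n X 1.
  by apply: DX; rewrite ler01 lexx.
exists (c / 2); first by rewrite divr_gt0.
split; first by move=> j; rewrite [LHS]linearZ /= sX.
move=> t /andP[t0 t1] C; under [X in pact X _]eq_fun do rewrite scalerA.
have [u1|u1] := lerP (t * (1 + c / 2)) 1.
  by apply: DX; rewrite u1 andbT mulr_ge0 // addr_ge0 // divr_ge0 // ltW.
apply: Hc; rewrite ger0_norm ?subr_ge0 ?ltW //.
have : t * (1 + c / 2) <= 1 + c / 2 by rewrite ler_piMl // addr_ge0 // divr_ge0 // ltW.
lra.
Qed.

Hypothesis midpoint : forall n (X Y : 'I_g -> 'M[R]_n),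
  segment_domain X -> segment_domain Y -> segment_domain (fun j => 2^-1 *: (X j + Y j)).

(* Averaging [X] with its conjugate by the reflection [2 W W^T - 1] gives a point
   of the domain for which the range of [W] is invariant. *)
Lemma segment_domain_compression n m (X : 'I_g -> 'M[R]_n) (W : 'M[R]_(n, m)) :
  W^T *m W = 1%:M -> segment_domain X -> segment_domain (fun j => W^T *m X j *m W).
Proof.
move=> WW DX; pose U : 'M[R]_n := 2 *: (W *m W^T) - 1%:M.
have UT : U^T = U.
  by rewrite /U [LHS]linearB /= [(_ *: _)^T]linearZ /= trmx_mul trmxK trmx1.
have UW : U *m W = W.
  rewrite mulmxBl -scalemxAl -mulmxA WW mulmx1 mul1mx.
  by rewrite -[X in _ - X]scale1r -scalerBl [2 - 1](_ : _ = 1) ?scale1r //; lra.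
have UU : U^T *m U = 1%:M.
  rewrite UT {2}/U mulmxBr mulmx1 -scalemxAr mulmxA UW /U opprB addrCA subrr.
  by rewrite addr0.
have WU : W^T *m U^T = W^T by rewrite -trmx_mul UW.
have [sX _] := DX.
have DZ := midpoint DX (segment_domain_conj UU DX).
set Z := fun j => _ in DZ.
have ZW j : Z j *m W = W *m (W^T *m X j *m W).
  rewrite /Z -scalemxAl mulmxDl UT -[U *m X j *m U *m W]mulmxA UW -[U *m _ *m W]mulmxA.
  rewrite mulmxBl mul1mx addrC subrK -scalemxAl scalerA mulVf ?pnatr_eq0 // scale1r.
  by rewrite !mulmxA.
split; first by move=> j; rewrite !trmx_mul trmxK sX mulmxA.
move=> t t01 C HC; have /(DZ.2 t t01) : pact (fun j => t *: Z j) (W *m C) = 0.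
  rewrite (pact_intertwine (Y := fun j => t *: (W^T *m X j *m W))) ?HC ?mulmx0 // => j.
  by rewrite -scalemxAl -scalemxAr ZW.
by move/(congr1 (mulmx W^T)); rewrite mulmxA WW mul1mx mulmx0.
Qed.

End Domain.

(** * Comparison with the connected component of 0 *)

Section Component.
Variables (R : realType) (g delta : nat) (p : free_poly R g delta).

(** The segment from 0 to [X] is a connected set of symmetric tuples at which [p] is invertible. *)
Lemma segment_domain_component n (X : 'I_g -> 'M[R]_n) :
  segment_domain p X -> invertibility_component p n X.
Proof.
move=> [sX DX].
pose f t : {ptws 'I_g -> 'M[R]_n} := fun j => t *: X j.
have f_cont : continuous f.
  move=> t; apply/cvg_sup => j U.
  rewrite nbhsE /= => -[B [[C oC <-] Cf]] BU.
  apply: (@filterS _ (nbhs t) _ _ _ (fun x => BU (f x))).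
  apply: (@scalel_continuous R 'M[R]_n (X j) t C).
  by apply: open_nbhs_nbhs; split.
apply: (connected_component_max (B := f @` `[0, 1])).
- exists 0; first by rewrite /= in_itv /= lexx ler01.
  by apply/funext => j; rewrite /f scale0r.
- move=> _ [t t01 <-]; split; first by move=> j; rewrite [LHS]linearZ /= sX.
  by apply/fp_eval_unitP; apply: DX; move: t01; rewrite /= in_itv.
- apply: connected_continuous_connected; first exact: segment_connected.
  exact: continuous_subspaceT.
- exists 1; first by rewrite /= in_itv /= lexx ler01.
  by apply/funext => j; rewrite /f scale1r.
Qed.

Hypothesis p0_unit : p [::] \in unitmx.

Lemma convex_component_segment n (X : 'I_g -> 'M[R]_n) :
  convex_set (invertibility_component p n) ->
  invertibility_component p n X -> segment_domain p X.
Proof.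
move=> cD DX.
have D0 : invertibility_component p n (fun=> 0).
  apply: connected_component_refl; split; first by move=> j; rewrite trmx0.
  apply/fp_eval_unitP => C Cp.
  have {}Cp : C *m (p [::])^T = 0.
    rewrite -(pact0X p (fun=> 0)) -[RHS]Cp; congr pact.
    by apply/funext => j; rewrite scaler0.
  have uP : (p [::])^T \in unitmx by rewrite unitmx_tr.
  by rewrite -(mulmxK uP C) Cp mul0mx.
have [sX _] := connected_component_sub DX.
split=> // t /andP[t0 t1].
have ZE : (fun j => t *: X j) = (fun j => t *: X j + (1 - t) *: (0 : 'M[R]_n)).
  by apply/funext => j; rewrite scaler0 addr0.
have /set_mem := cD X (fun=> 0) (Itv01 t0 t1) (mem_set DX) (mem_set D0).
rewrite ZE => /connected_component_sub[_ /fp_eval_unitP].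
exact.
Qed.

Lemma convex_component_midpoint n (X Y : 'I_g -> 'M[R]_n) :
    ((0 < n)%N -> convex_set (invertibility_component p n)) ->
  segment_domain p X -> segment_domain p Y ->
  segment_domain p (fun j => 2^-1 *: (X j + Y j)).
Proof.
(* Convexity is available for positive sizes only; at size 0 every matrix is zero. *)
move=> cD DX DY; have [n0|n_gt0] := posnP n.
  by subst n; split=> [j|t _ C _]; apply/matrixP => -[].
have half01 : 0 <= 2^-1 :> R /\ 2^-1 <= 1 :> R by split; lra.
apply: (convex_component_segment (cD n_gt0)).
have /set_mem := cD n_gt0 X Y (Itv01 half01.1 half01.2)
  (mem_set (segment_domain_component DX)) (mem_set (segment_domain_component DY)).
have -> : (fun j => 2^-1 *: (X j + Y j)) = (fun j => 2^-1 *: X j + (1 - 2^-1) *: Y j).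
  apply/funext => j; rewrite scalerDr; congr (_ + _ *: _); lra.
exact.
Qed.

End Component.

(** * The quadratic form of a monic pencil *)

Section MonicPencilForm.
Variables (R : realType) (g : nat).

Lemma mxtrace_gram_gt0 n k (C : 'M[R]_(n, k)) : C != 0 -> 0 < \tr (C^T *m C).
Proof.
have CE : \tr (C^T *m C) = \sum_i \sum_j C j i ^+ 2.
  apply: eq_bigr => i _; rewrite mxE; apply: eq_bigr => j _.
  by rewrite mxE expr2.
move=> C0; rewrite lt_neqAle eq_sym CE; apply/andP; split; last first.
  by do 2 apply: sumr_ge0 => ? _; rewrite sqr_ge0.
apply: contra_neq C0 => /eqP; rewrite psumr_eq0 => [/allP H|? _]; last first.
  by apply: sumr_ge0 => ? _; rewrite sqr_ge0.
apply/matrixP => j i; have := H i (mem_index_enum _); rewrite [RHS]mxE /=.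
rewrite psumr_eq0 => [/allP/(_ j (mem_index_enum _))|? _]; last by rewrite sqr_ge0.
by rewrite /= sqrf_eq0 => /eqP.
Qed.

Lemma big_option (f : option 'I_g -> R) :
  \sum_a f a = f None + \sum_j f (Some j).
Proof.
rewrite (bigD1 None) //= (reindex_omap Some id) /=; last by case.
by congr (_ + _); apply: eq_bigl => j; rewrite eqxx.
Qed.

(** Since the pencil is monic, its form is affine in [t], with value tr(C^T C) at t = 0; this yields
    both strictness and star-shapedness later. *)
Lemma mxpairZ n k (A : 'I_g -> 'M[R]_k) (X : 'I_g -> 'M[R]_n) (C : 'M[R]_(n, k)) t :
  mxpair (pencil A) (gram (fun j => t *: X j) C) =
  t * mxpair (pencil A) (gram X C) + (1 - t) * \tr (C^T *m C).
Proof.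
rewrite /mxpair !big_option; set x := \sum_j _; set y := \sum_j _.
have -> : x = t * y.
  rewrite /x /y mulr_sumr; apply: eq_bigr => j _.
  by rewrite /gram /= -scalemxAr -scalemxAl -scalemxAr linearZ.
by rewrite /gram /= !mul1mx !mulmx1; ring.
Qed.

Lemma posdef_monic_pencil n k (A : 'I_g -> 'M[R]_k) (X : 'I_g -> 'M[R]_n) :
  symmetric_tuples A -> symmetric_tuples X ->
  posdef (fp_eval (monic_pencil A) X) <->
  forall C : 'M[R]_(n, k), C != 0 -> 0 < mxpair (pencil A) (gram X C).
Proof.
move=> sA sX.
have formE v : (v^T *m fp_eval (monic_pencil A) X *m v) 0 0 =
    mxpair (pencil A) (gram X (unvec v)).
  rewrite fp_eval_monic_pencil mulmxBr mulmxBl mulmx1 [LHS]mxE /mxpair big_option.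
  rewrite unvec_dot /gram /= mul1mx mulmx1; congr (_ + _).
  rewrite mxE mulmx_sumr mulmx_suml summxE -sumrN; apply: eq_bigr => j _.
  rewrite -mulmxA unvec_dot unvec_tens sA mulNmx linearN /=.
  by rewrite !mulmxA mxtrace_mulC !mulmxA.
split=> [[_ H] C C0|H].
  have [v vC] := unvec_surj C; rewrite -vC -formE; apply: H.
  by rewrite -unvec_eq0 vC.
split=> [|v v0]; last by rewrite formE; apply: H; rewrite unvec_eq0.
rewrite fp_eval_monic_pencil [LHS]linearB /= trmx1 linear_sum /=; congr (_ - _).
by apply: eq_bigr => j _; rewrite trmx_tens sA sX.
Qed.

End MonicPencilForm.

(** * Krylov matrices indexed by short words *)

Section Krylov.
Variables (R : realType) (g delta h : nat).

(** Tagging each word with its length makes the type finite and its cardinality a geometric sum. *)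
Definition short_word : finType := {m : 'I_h.+1 & m.-tuple 'I_g}.

Definition word_of (x : short_word) : seq 'I_g := tval (tagged x).

Lemma word_of_surj w : (size w <= h)%N -> exists x, word_of x = w.
Proof.
rewrite -ltnS => wh.
by exists (Tagged (fun m : 'I_h.+1 => m.-tuple 'I_g) (in_tuple w : (Ordinal wh).-tuple 'I_g)).
Qed.

Lemma word_of_inj : injective word_of.
Proof.
move=> [[m mh] t] [[m' mh'] t']; rewrite /word_of /= => tt'.
have mm' : m = m' by have := congr1 size tt'; rewrite !size_tuple.
subst m'; rewrite (bool_irrelevance mh' mh) in t' tt' *.
by congr Tagged; apply: val_inj.
Qed.

Definition krylov_dim := #|{: short_word * 'I_delta}|.

Lemma krylov_dimE : krylov_dim = (delta * \sum_(0 <= j < h.+1) g ^ j)%N.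
Proof.
rewrite /krylov_dim card_prod card_ord mulnC; congr (_ * _)%N.
rewrite card_tagged sumnE big_map big_enum /= big_mkord.
by apply: eq_bigr => j _; rewrite card_tuple card_ord.
Qed.

(* [Phi] in the notation of the header. *)
Definition krylov n (X : 'I_g -> 'M[R]_n) (v : 'M[R]_(n, delta)) : 'M[R]_(n, krylov_dim) :=
  \matrix_(a, i) (word_eval X (word_of (enum_val i).1) *m v) a (enum_val i).2.

Definition word_block (w : seq 'I_g) : 'M[R]_(krylov_dim, delta) :=
  \matrix_(i, b) ((word_of (enum_val i).1 == w) && ((enum_val i).2 == b))%:R.

Lemma krylov_block n (X : 'I_g -> 'M[R]_n) v w : (size w <= h)%N ->
  krylov X v *m word_block w = word_eval X w *m v.
Proof.
move=> /word_of_surj[x xw]; apply/matrixP => a b; rewrite mxE.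
rewrite (bigD1 (enum_rank (x, b))) //= [krylov _ _ _ _]mxE [word_block _ _ _]mxE.
rewrite enum_rankK /= xw !eqxx mulr1 big1 ?addr0 // => i ib; rewrite !mxE.
case: eqP => [wi|_]; last by rewrite mulr0.
case: eqP => [bi|_]; last by rewrite mulr0.
case/eqP: ib; apply: enum_val_inj; rewrite enum_rankK [LHS]surjective_pairing bi.
by congr (_, _); apply: word_of_inj; rewrite wi.
Qed.

Lemma krylov_dsum n1 n2 (X1 : 'I_g -> 'M[R]_n1) (X2 : 'I_g -> 'M[R]_n2) v1 v2 :
  krylov (dsum X1 X2) (col_mx v1 v2) = col_mx (krylov X1 v1) (krylov X2 v2).
Proof.
apply/matrixP => a i; rewrite mxE word_eval_dsum mul_block_col !mul0mx addr0 add0r.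
by case: (split_ordP a) => a' ->; rewrite ?col_mxEu ?col_mxEd [RHS]mxE.
Qed.

Lemma krylovZ n (X : 'I_g -> 'M[R]_n) c v : krylov X (c *: v) = c *: krylov X v.
Proof. by apply/matrixP => a i; rewrite [LHS]mxE -scalemxAr !mxE. Qed.

End Krylov.

Arguments krylov {R g delta} h {n} X v.
Arguments word_block {R g delta h} w.

(** * Gram data of a null vector of p(X) is not Gram data of the domain *)

Section Kernels.
Variables (R : realType) (g delta : nat) (p : free_poly R g delta).
Hypothesis midpoint : forall n (X Y : 'I_g -> 'M[R]_n),
  segment_domain p X -> segment_domain p Y ->
  segment_domain p (fun j => 2^-1 *: (X j + Y j)).

(** Compressing [Z] to the range of [C] gives a point [Y] of the domain and a factor [F] of full row
    rank. The Gram data then forces [Y] to act on the blocks of [F] as [X] acts on those of the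
    Krylov matrix, while words stay within length [h]. *)
Lemma krylov_transfer h n (X : 'I_g -> 'M[R]_n) (v : 'M[R]_(n, delta)) :
    gram_cone (segment_domain p) (gram X (krylov h X v)) ->
  exists r (Y : 'I_g -> 'M[R]_r) (F : 'M[R]_(r, krylov_dim g delta h)),
  [/\ segment_domain p Y,
      forall a, F^T *m ext Y a *m F = gram X (krylov h X v) a &
      forall w, (size w <= h)%N ->
        word_eval Y w *m (F *m word_block [::]) = F *m word_block w].
Proof.
set K := krylov h X v => -[m [Z [C [DZ E]]]].
have KK : C^T *m C = K^T *m K by have := E None; rewrite /gram /= !mulmx1.
have pK : psd (K^T *m K).
  have := psd_congr K (T := 1%:M); rewrite mulmx1; apply.
  split=> [|u]; first exact: trmx1.
  by rewrite mulmx1 mxE sumr_ge0 // => i _; rewrite mxE -expr2 sqr_ge0.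
have [r [F [G [TE FG]]]] := psd_factor pK.
(* [C] and [F] have equal Gram matrices, hence equal kernels, and [F] kills 1 - G F. *)
have CGF : C *m G *m F = C.
  apply/eqP; rewrite -subr_eq0; apply/eqP/mulmx_tr_eq0.
  have TGF : C^T *m (C *m G *m F) = C^T *m C.
    by rewrite !mulmxA KK TE -[F^T *m F *m G]mulmxA FG mulmx1.
  rewrite [(_ - _)^T]linearB /= mulmxBl !mulmxBr TGF subrr subr0.
  have -> : (C *m G *m F)^T = (G *m F)^T *m C^T by rewrite -mulmxA trmx_mul.
  by rewrite -[_ *m C^T *m _]mulmxA TGF mulmxA subrr.
have WW : (C *m G)^T *m (C *m G) = 1%:M.
  rewrite trmx_mul -mulmxA [C^T *m _]mulmxA KK TE !mulmxA.
  by rewrite -trmx_mul FG trmx1 mul1mx.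
pose Y j := (C *m G)^T *m Z j *m (C *m G).
have FY a : F^T *m ext Y a *m F = gram X K a.
  case: a => [j|]; last by rewrite /= mulmx1 -TE /gram /= mulmx1.
  by rewrite E /= /gram /Y -[in RHS]CGF !trmx_mul !mulmxA.
have DY : segment_domain p Y by exact: segment_domain_compression.
clearbody Y; exists r, Y, F; split=> //.
have F_inj A B : F^T *m A = F^T *m B -> A = B :> 'M[R]_(r, delta).
  by move/(congr1 (mulmx G^T)); rewrite !mulmxA -trmx_mul FG trmx1 !mul1mx.
elim=> [|j w IH] wh; first by rewrite word_eval_nil mul1mx.
(* With e_w the block of w: F^T Y_j F e_w = K^T X_j K e_w = K^T K e_jw = F^T F e_jw, and F^T is
   injective. *)
rewrite word_eval_cons -mulmxA IH ?(ltnW wh) //; apply: F_inj.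
rewrite !mulmxA [F^T *m Y j *m F](FY (Some j)) -TE /gram /=.
rewrite -[_ *m K *m _]mulmxA krylov_block ?(ltnW wh) //.
rewrite -[in RHS]mulmxA krylov_block // word_eval_cons.
by rewrite !mulmxA.
Qed.

Lemma segment_domain_kernel n (X : 'I_g -> 'M[R]_n) C :
  segment_domain p X -> pact p X C = 0 -> C = 0.
Proof.
move=> [_ DX] XC; apply: (DX 1); first by rewrite ler01 lexx.
by rewrite -[RHS]XC; congr pact; apply/funext => j; rewrite scale1r.
Qed.

(** When [h] reaches the degree, p(X) v is a fixed combination of Krylov columns. That it vanishes
    is visible in the Gram matrix, so the same combination vanishes for [Y], where p(Y) is
    injective. *)
Lemma krylov_kernel_full h n (X : 'I_g -> 'M[R]_n) (v : 'M[R]_(n, delta)) :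
    (fp_degree p <= h)%N -> pact p X v = 0 ->
    gram_cone (segment_domain p) (gram X (krylov h X v)) ->
  v = 0.
Proof.
move=> ph Xv /krylov_transfer[r [Y [F [DY FY wY]]]].
have FF := FY None; rewrite /gram /= !mulmx1 in FF.
have sizeh w : w \in finsupp p -> (size w <= h)%N.
  by move=> wp; apply: leq_trans ph; apply: leq_bigmax_seq.
have K0 : F *m word_block [::] = 0.
  apply: (segment_domain_kernel DY).
  pose P : 'M[R]_(krylov_dim g delta h, delta) :=
    \sum_(w <- finsupp p) word_block w *m (p w)^T.
  have -> : pact p Y (F *m word_block [::]) = F *m P.
    rewrite /pact /P mulmx_sumr [LHS]big_seq [RHS]big_seq; apply: eq_bigr => w /sizeh wh.
    by rewrite wY // mulmxA.
  have KP : krylov h X v *m P = 0.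
    rewrite -Xv /pact /P mulmx_sumr [LHS]big_seq [RHS]big_seq.
    by apply: eq_bigr => w /sizeh wh; rewrite mulmxA krylov_block.
  apply: mulmx_tr_eq0; rewrite trmx_mul mulmxA -[_ *m F^T *m F]mulmxA FF.
  by rewrite mulmxA -[_ *m krylov h X v *m P]mulmxA KP mulmx0.
have vE : krylov h X v *m word_block [::] = v.
  by rewrite krylov_block // word_eval_nil mul1mx.
apply: mulmx_tr_eq0; rewrite -{1 2}vE trmx_mul mulmxA -[_ *m _^T *m krylov h X v]mulmxA.
by rewrite -FF mulmxA -mulmxA K0 mulmx0.
Qed.

(** * The case p(0) = I: positivity on the domain and half-length words *)

Section PositiveAtZero.
Hypothesis p_sym : fp_symmetric p.
Hypothesis p0_one : p [::] = 1%:M.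

Lemma fp_eval_sym n (X : 'I_g -> 'M[R]_n) : symmetric_tuples X ->
  (fp_eval p X)^T = fp_eval p X.
Proof.
move=> sX; have pE w : (p w)^T = p (rev w).
  by rewrite -{1}p_sym fp_adjE trmxK.
rewrite /fp_eval linear_sum /=.
rewrite (eq_bigr (fun w => p (rev w) *t word_eval X (rev w))); last first.
  by move=> w _; rewrite trmx_tens pE word_eval_tr.
rewrite -(big_map rev xpredT (fun w => p w *t word_eval X w)).
apply: perm_big; apply: uniq_perm; rewrite ?fset_uniq //.
  by rewrite map_inj_uniq ?fset_uniq //; exact: can_inj revK.
move=> w; rewrite -[w in LHS]revK mem_map; last exact: can_inj revK.
by rewrite !mem_finsupp -pE trmx_eq0.
Qed.

Lemma fp_eval_form n (X : 'I_g -> 'M[R]_n) v :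
  (v^T *m fp_eval p X *m v) 0 0 = \tr ((unvec v)^T *m pact p X (unvec v)).
Proof. by rewrite -mulmxA unvec_dot unvec_fp_eval. Qed.

(** The symmetric matrix p(tX) starts at the identity and stays invertible, so it cannot lose
    positivity. The supremum [b] of the good parameters is good by continuity, and [psd_near] would
    move past it if b < 1. *)
Lemma segment_domain_psd n (X : 'I_g -> 'M[R]_n) :
  segment_domain p X -> psd (fp_eval p X).
Proof.
move=> [sX DX]; have [M ME] := fp_eval_poly p X.
have sM t : (map_mx (horner_eval t) M)^T = map_mx (horner_eval t) M.
  by rewrite -ME fp_eval_sym // => j; rewrite [LHS]linearZ /= sX.
have uM t : 0 <= t <= 1 -> map_mx (horner_eval t) M \in unitmx.
  by move=> t01; rewrite -ME; apply/fp_eval_unitP/DX.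
pose good t := 0 <= t <= 1 /\ forall s, 0 <= s <= t -> psd (map_mx (horner_eval s) M).
have good0 : good 0.
  split=> [|s]; first by rewrite lexx ler01.
  move=> /le_anti <-; split=> // v; rewrite -ME fp_eval_form pact0X p0_one trmx1 mulmx1.
  by rewrite -unvec_dot mxE sumr_ge0 // => i _; rewrite mxE -expr2 sqr_ge0.
have good_sup : has_sup [set t | good t].
  by split; [exists 0 | exists 1 => t [/andP[]]].
set b := sup [set t | good t].
have b0 : 0 <= b by apply: ub_le_sup => //; exact: good_sup.2.
have b1 : b <= 1 by apply: ge_sup; [exists 0 | move=> t [/andP[]]].
have psd_lt s : 0 <= s < b -> psd (map_mx (horner_eval s) M).
  move=> /andP[s0 sb]; have [|t [_ gt] st] := sup_adherent (_ : 0 < b - s) good_sup.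
    by rewrite subr_gt0.
  by apply: gt; rewrite s0 ltW //; move: st; rewrite opprB addrC subrK.
have psd_b : psd (map_mx (horner_eval b) M).
  split=> // v; pose q := ((map_mx polyC v)^T *m M *m map_mx polyC v) 0 0.
  have qE t : q.[t] = (v^T *m map_mx (horner_eval t) M *m v) 0 0.
    rewrite -[LHS]/(horner_eval t q) /q.
    transitivity (map_mx (horner_eval t) ((map_mx polyC v)^T *m M *m map_mx polyC v) 0 0).
      by rewrite [RHS]mxE.
    by rewrite !map_mxM -map_trmx -!map_mx_comp !map_horner_polyC.
  rewrite -qE leNgt; apply/negP => qb.
  have [b00|bn0] := eqVneq b 0.
    by move: qb; rewrite b00 qE ltNge; case/negP; apply: (good0.2 0 _).2; rewrite lexx.
  have bp : 0 < b by rewrite lt_neqAle eq_sym bn0.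
  (* A negative value at [b] would remain negative at some s < b, where the matrix is positive
     semidefinite. *)
  have [c c0 Hc] := poly_cont b q (e := - q.[b]) (eqbRL (oppr_gt0 _) qb).
  pose s := Num.max 0 (b - c / 2).
  have s0 : 0 <= s by rewrite le_max lexx.
  have sb : s < b by rewrite gt_max bp /=; lra.
  have sc : b - c / 2 <= s by rewrite le_max lexx orbT.
  have := Hc s; rewrite ltr0_norm ?subr_lt0 // => Hs.
  have {Hs}/Hs : - (s - b) < c by lra.
  have := (psd_lt s _).2 v; rewrite s0 sb -qE => /(_ isT) qs.
  rewrite ger0_norm; lra.
have [|c c0 Hc] := psd_near sM psd_b; first by apply: uM; rewrite b0.
have b1' : b = 1.
  apply/eqP; rewrite eq_le b1 leNgt; apply/negP => blt.
  pose t := Num.min 1 (b + c / 2).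
  have tb : b < t by rewrite lt_min blt /=; lra.
  have tc : t <= b + c / 2 by rewrite ge_min lexx orbT.
  have : t <= b.
    apply: ub_le_sup; first exact: good_sup.2.
    split=> [|s /andP[s0 st]].
      by rewrite (ltW (le_lt_trans b0 tb)) ge_min lexx.
    have [sb|bs] := ltP s b; first by apply: psd_lt; rewrite s0.
    by apply: Hc; rewrite ger0_norm ?subr_ge0 //; lra.
  by rewrite leNgt tb.
rewrite -[fp_eval p X](_ : map_mx (horner_eval 1) M = _); first by rewrite -b1'.
by rewrite -ME; congr fp_eval; apply/funext => j; rewrite scale1r.
Qed.

Lemma segment_domain_pos n (X : 'I_g -> 'M[R]_n) C :
  segment_domain p X -> C != 0 -> 0 < \tr (C^T *m pact p X C).
Proof.
move=> DX C0; have pX := segment_domain_psd DX; have [v vC] := unvec_surj C.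
rewrite -vC -fp_eval_form lt_neqAle eq_sym pX.2 andbT.
apply: contra_neq C0 => /(psd_kernel pX) Xv.
apply: (segment_domain_kernel DX).
by rewrite -vC -unvec_fp_eval Xv unvec0.
Qed.

(** A word of length at most 2h + 1 is u j w' with [u] and [w'] of length at most [h], so all
    moments entering v^T p(X) v are read from the Gram data, the middle letter from its x_j part.
    The form of p(Y) therefore vanishes at [c], and p(Y) is positive definite. *)
Lemma krylov_kernel_half h n (X : 'I_g -> 'M[R]_n) (v : 'M[R]_(n, delta)) :
    (fp_degree p <= h.*2.+1)%N -> symmetric_tuples X -> pact p X v = 0 ->
    gram_cone (segment_domain p) (gram X (krylov h X v)) ->
  v = 0.
Proof.
move=> ph sX Xv /krylov_transfer[r [Y [F [DY FY wY]]]].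
have FF := FY None; rewrite /gram /= !mulmx1 in FF.
set c := F *m word_block [::] in wY.
have sizeh w : w \in finsupp p -> (size w <= h.*2.+1)%N.
  by move=> wp; apply: leq_trans ph; apply: leq_bigmax_seq.
have vE : krylov h X v *m word_block [::] = v.
  by rewrite krylov_block // word_eval_nil mul1mx.
have XK w : (size w <= h)%N -> word_eval X w *m v = krylov h X v *m word_block w.
  by move=> wh; rewrite krylov_block.
have moment w : (size w <= h.*2.+1)%N ->
    c^T *m word_eval Y w *m c = v^T *m word_eval X w *m v.
  move=> wh; rewrite -(cat_take_drop h w) !word_eval_cat.
  set u := take h w; have uh : (size (rev u) <= h)%N.
    by rewrite size_rev size_take; case: ltnP.
  have split_u m (Z : 'I_g -> 'M[R]_m) (e : 'M[R]_(m, delta)) B : symmetric_tuples Z ->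
      e^T *m (word_eval Z u *m B) *m e = (word_eval Z (rev u) *m e)^T *m (B *m e).
    by move=> sZ; rewrite trmx_mul word_eval_tr // revK !mulmxA.
  rewrite !split_u //; last exact: DY.1.
  rewrite [word_eval Y (rev u) *m c]wY // [word_eval X (rev u) *m v]XK //.
  (* An empty remainder means length at most [h], and the constant Gram matrix suffices. *)
  case: (drop h w) (size_drop h w) => [|j w'] /= sw.
    rewrite !word_eval_nil !mul1mx -{2}vE /c !trmx_mul -!mulmxA.
    by rewrite [F^T *m _]mulmxA FF !mulmxA.
  have wh' : (size w' <= h)%N.
    by rewrite -ltnS sw leq_subLR addnS addnn.
  rewrite !word_eval_cons -!mulmxA wY // XK //.
  rewrite !trmx_mul -!mulmxA [Y j *m _]mulmxA [F^T *m _]mulmxA [F^T *m _]mulmxA.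
  by rewrite (FY (Some j)) /gram /= !mulmxA.
have tr0 : \tr (c^T *m pact p Y c) = 0.
  transitivity (\tr (v^T *m pact p X v)); last by rewrite Xv mulmx0 linear0.
  congr (\tr _); rewrite /pact !mulmx_sumr [LHS]big_seq [RHS]big_seq.
  by apply: eq_bigr => w /sizeh wh; rewrite mulmxA [c^T *m _]mulmxA moment // !mulmxA.
have c0 : c = 0.
  by apply/eqP/negPn/negP => /(segment_domain_pos DY); rewrite tr0 ltxx.
apply: mulmx_tr_eq0; rewrite -{1 2}vE trmx_mul mulmxA -[_ *m _^T *m krylov h X v]mulmxA.
by rewrite -FF mulmxA -mulmxA -/c c0 mulmx0.
Qed.

End PositiveAtZero.
End Kernels.

(** * The domain as the positivity domain of a monic pencil *)

Section Representation.
Variables (R : realType) (g delta : nat) (p : free_poly R g delta).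
Hypothesis g_gt0 : (0 < g)%N.
Hypothesis p0_unit : p [::] \in unitmx.
Hypothesis midpoint : forall n (X Y : 'I_g -> 'M[R]_n),
  segment_domain p X -> segment_domain p Y ->
  segment_domain p (fun j => 2^-1 *: (X j + Y j)).

Lemma krylov_pencil h :
    (forall n (X : 'I_g -> 'M[R]_n) v, symmetric_tuples X -> pact p X v = 0 ->
       gram_cone (segment_domain p) (gram X (krylov h X v)) -> v = 0) ->
  exists A : 'I_g -> 'M[R]_(krylov_dim g delta h), symmetric_tuples A /\
    forall n (X : 'I_g -> 'M[R]_n),
      segment_domain p X <-> positivity_domain (monic_pencil A) n X.
Proof.
move=> noker.
pose F n (X : 'I_g -> 'M[R]_n) P := exists v : 'M[R]_(n, delta),
  [/\ symmetric_tuples X, v != 0, pact p X v = 0 & P = krylov h X v].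
have [|||||||A [sA pA nA]] := @separating_pencil R g g_gt0 (segment_domain p) _ _ _ _ F.
- by move=> n X [].
- exact: segment_domain_dsum.
- exact: segment_domain_absorbing.
- by move=> n X P [v []].
- move=> n1 n2 X1 X2 P1 P2 [v1 [s1 n10 e1 ->]] [v2 [s2 n20 e2 ->]].
  exists (col_mx v1 v2); split.
  + by move=> j; rewrite /dsum tr_block_mx s1 s2 !trmx0.
  + by apply: contra_neq n10; rewrite -col_mx0 => /eq_col_mx[].
  + by rewrite pact_dsum e1 e2 col_mx0.
  + by rewrite krylov_dsum.
- move=> n X P c c0 [v [sX v0 Xv ->]]; exists (c *: v); split=> //.
  + by rewrite scaler_eq0 negb_or v0 gt_eqF.
  + by rewrite pactZ Xv scaler0.
  + by rewrite krylovZ.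
- by move=> n X P [v [sX /eqP v0 Xv ->]] /(noker _ _ _ sX Xv).
exists A; split=> // n X.
split=> [DX|[sX /(posdef_monic_pencil sA sX) LX]].
  split; first exact: DX.1.
  apply/posdef_monic_pencil => //; first exact: DX.1.
  (* With q the form at [X], nonnegativity at (1 + c) X reads (1 + c) q >= c tr(C^T C), so q is
     positive. *)
  move=> C C0; have [c c0 DcX] := segment_domain_open DX.
  have := pA _ _ C DcX; rewrite mxpairZ; have := mxtrace_gram_gt0 C0.
  nra.
(* If p(tX) were singular, the pencil would fail to be positive at tX, yet its form there is a
   convex combination of positive values at [X] and at 0. *)
split=> // t /andP[t0 t1] C XC; apply/eqP/negPn/negP => C0.
have [|C' C'0] := nA n (fun j => t *: X j) (krylov h (fun j => t *: X j) C).
  by exists C; split=> // j; rewrite [LHS]linearZ /= sX.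
rewrite mxpairZ; have := LX _ C'0; have := mxtrace_gram_gt0 C'0.
nra.
Qed.

End Representation.

Theorem theorem7p5 (R : realType) (g delta d : nat) (p : free_poly R g delta)
    (hg : (0 < g)%N) (hdelta : (0 < delta)%N)
    (p_sym : fp_symmetric p) (p_deg : fp_degree p = d)
    (p0_unit : p [::] \in unitmx)
    (Dp_bounded : free_bounded (invertibility_component p))
    (Dp_convex : free_convex (invertibility_component p)) :
  let nu := (delta * \sum_(0 <= j < d.+1) g ^ j)%N in
  let nu_breve := (delta * \sum_(0 <= j < (d %/ 2).+1) g ^ j)%N in
  (exists l : nat, [/\ (0 < l)%N, (l <= nu * (nu + 1) %/ 2)%N &
     exists A : 'I_g -> 'M[R]_l, (forall j, (A j)^T = A j) /\
       forall n : nat, (0 < n)%N ->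
         invertibility_component p n
         = positivity_domain (monic_pencil A) n])
  /\
  (p [::] = 1%:M ->
   exists l : nat, [/\ (0 < l)%N, (l <= nu_breve * (nu_breve + 1) %/ 2)%N &
     exists A : 'I_g -> 'M[R]_l, (forall j, (A j)^T = A j) /\
       forall n : nat, (0 < n)%N ->
         invertibility_component p n
         = positivity_domain (monic_pencil A) n]).
Proof.
move=> nu nu_breve.
have midpoint n (X Y : 'I_g -> 'M[R]_n) := convex_component_midpoint p0_unit
  (X := X) (Y := Y) (@Dp_convex n).
have componentE n (X : 'I_g -> 'M[R]_n) : (0 < n)%N ->
    invertibility_component p n X <-> segment_domain p X.
  move=> n0; split; last exact: segment_domain_component.
  exact/convex_component_segment/Dp_convex.
have conclude h :
    (forall n (X : 'I_g -> 'M[R]_n) v, symmetric_tuples X -> pact p X v = 0 ->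
       gram_cone (segment_domain p) (gram X (krylov h X v)) -> v = 0) ->
    let m := (delta * \sum_(0 <= j < h.+1) g ^ j)%N in
    exists l : nat, [/\ (0 < l)%N, (l <= m * (m + 1) %/ 2)%N &
     exists A : 'I_g -> 'M[R]_l, (forall j, (A j)^T = A j) /\
       forall n : nat, (0 < n)%N ->
         invertibility_component p n = positivity_domain (monic_pencil A) n].
  move=> noker m; have [A [sA AE]] := krylov_pencil hg p0_unit noker.
  have m_gt0 : (0 < m)%N by rewrite muln_gt0 hdelta big_nat_recl.
  (* The pencil has size exactly m, and m <= m (m + 1) / 2 because m is positive. *)
  exists (krylov_dim g delta h); rewrite {1 2}krylov_dimE; split=> //.
    by rewrite leq_divRL // leq_mul2l addn1 ltnS m_gt0 orbT.
  exists A; split=> // n n0; apply/seteqP; split=> X.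
    by move/(componentE _ _ n0)/AE.
  by move/AE/(componentE _ _ n0).
split; first by apply: (conclude d) => n X v _; apply: krylov_kernel_full; rewrite ?p_deg.
move=> p0_one; apply: (conclude (d %/ 2)%N) => n X v.
apply: krylov_kernel_half => //.
(* d is at most 2 [d/2] + 1, with equality for odd d. *)
by rewrite p_deg -{1}(odd_double_half d) divn2 -add1n leq_add2r leq_b1.
Qed.
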